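(* Let $d\ge 1$, $\Omega=\mathbb{R}^{d-1}\times(0,+\infty)$ and $T>0$. Assume that $H:[0,T]\times\overline\Omega\times\mathbb{R}^d\to\mathbb{R}$ satisfies conditions (H-i)–(H-iv) and that $F:[0,T]\times\partial\Omega\times\mathbb{R}^d\to\mathbb{R}$ satisfies conditions (F-i)–(F-iv), all listed in the context. Assume that $u_0:\overline\Omega\to\mathbb{R}$ is uniformly continuous. Let $u,v:[0,T)\times\overline\Omega\to\mathbb{R}$ be two functions with $u$ upper semi-continuous and $v$ lower semi-continuous. Assume that, in the viscosity sense, $$u_t+H(X,Du)\le 0 \ \text{ in } (0,T)\times\Omega,\qquad u_t+\min(F,H)(X,Du)\le 0\ \text{ on } (0,T)\times\partial\Omega,$$ $$v_t+H(X,Dv)\ge 0 \ \text{ in } (0,T)\times\Omega,\qquad v_t+\max(F,H)(X,Dv)\ge 0\ \text{ on } (0,T)\times\partial\Omega,$$ where $X=(t,x)$. Assume moreover that there exists a constant $C_T>0$ such that $$u(t,x)\le u_0(x)+C_T\quad\text{and}\quad v(t,x)\ge u_0(x)-C_T\quad\text{for all }(t,x)\in[0,T)\times\overline\Omega.$$ If $u(0,\cdot)\le u_0\le v(0,\cdot)$ on $\overline\Omega$, then $u\le v$ on $[0,T)\times\overline\Omega$.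
   Context: Notation: $X=(t,x)$ with $x=(x',x_d)\in\mathbb{R}^{d-1}\times[0,+\infty)$; gradients are written $p=(p',p_d)\in\mathbb{R}^{d-1}\times\mathbb{R}$; $Du$ is the gradient in $x$ (for $d=1$ there are no variables $x',p'$). Below $\omega$ and $\omega_L$ (for $L>0$) denote moduli of continuity, i.e. continuous nondecreasing functions $[0,+\infty)\to[0,+\infty)$ vanishing at $0$. Viscosity inequalities are understood with $C^1$ test functions: an upper semi-continuous $u$ is a subsolution if, whenever a $C^1$ function $\varphi$ on $(0,T)\times\overline\Omega$ touches $u$ from above at a point $X_0\in(0,T)\times\overline\Omega$ (locally, relative to $(0,T)\times\overline\Omega$), the stated inequality holds at $X_0$ with $(u_t,Du)$ replaced by $(\varphi_t,D\varphi)(X_0)$; supersolutions are defined similarly with touching from below and reversed inequalities. Conditions on $H$: (H-i) $H$ is continuous on $[0,T]\times\overline\Omega\times\mathbb{R}^d$ and $X\mapsto H(X,0)$ is bounded. (H-ii) For any $L>0$, for all $X\in[0,T]\times\overline\Omega$ and $p,q\in[-L,L]^d$: $|H(X,p)-H(X,q)|\le\omega_L(|p-q|)$. (H-iii) For all $X=(t,x',x_d)$ and $Y=(s,y',x_d)$ (same normal coordinate $x_d\ge 0$), with $t,s\in[0,T]$, $x',y'\in\mathbb{R}^{d-1}$, and all $p=(p',p_d)\in\mathbb{R}^d$: $H(Y,p)-H(X,p)\le\omega\big(|Y-X|(1+|p'|+\max\{0,H(X,p)\})\big)$. (H-iv) For any $L>0$: $\lim_{|p_d|\to+\infty}\inf\{H(X,p',p_d):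 X\in[0,T]\times\overline\Omega,\ p'\in[-L,L]^{d-1}\}=+\infty$. Conditions on $F$: (F-i) $F$ is continuous on $[0,T]\times\partial\Omega\times\mathbb{R}^d$, $X\mapsto F(X,0)$ is bounded, and $p_d\mapsto F(X,p',p_d)$ is nonincreasing. (F-ii) For any $L>0$, for all $X\in[0,T]\times\partial\Omega$ and $p,q\in[-L,L]^d$: $|F(X,p)-F(X,q)|\le\omega_L(|p-q|)$. (F-iii) For all $X,Y\in[0,T]\times\partial\Omega$ and $p\in\mathbb{R}^d$: $F(Y,p)-F(X,p)\le\omega\big(|Y-X|(1+|p'|+\max\{0,\max(F,H)(X,p)\})\big)$. (F-iv) For any $L>0$: $\lim_{p_d\to-\infty}\inf\{F(X,p',p_d): X\in[0,T]\times\partial\Omega,\ p'\in[-L,L]^{d-1}\}=+\infty$. *)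

(* Defs.v *)
From HB Require Import structures.
From mathcomp Require Export all_boot all_order all_algebra.
From mathcomp Require Export all_classical all_reals all_analysis.
Set Implicit Arguments.
Unset Strict Implicit.
Unset Printing Implicit Defensive.
Export Order.TTheory GRing.Theory Num.Theory.
Export numFieldNormedType.Exports.
Global Open Scope classical_set_scope.
Global Open Scope ring_scope.

(* x = (x', x_d) in R^(d-1) x R is encoded with n = d - 1; gradients in x have
   the same type. Functions on subsets of space-time are total; their values
   outside the sets mentioned in each condition are irrelevant. *)
Notation space R n := ('rV[R]_n * R)%type.
Notation spacetime R n := (R * ('rV[R]_n * R))%type.

Section Euclid.
Context {R : realType} {n : nat}.

Definition vdot (x y : 'rV[R]_n) : R := \sum_(i < n) x 0 i * y 0 i.
Definition sdot (x y : space R n) : R := vdot x.1 y.1 + x.2 * y.2.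
Definition stdot (X Y : spacetime R n) : R := X.1 * Y.1 + sdot X.2 Y.2.

(* Euclidean norms: the library norm on 'rV and on products is the sup norm. *)
Definition vnorm (x : 'rV[R]_n) : R := Num.sqrt (vdot x x).
Definition snorm (x : space R n) : R := Num.sqrt (sdot x x).
Definition stnorm (X : spacetime R n) : R := Num.sqrt (stdot X X).

Definition vbox (L : R) : set 'rV[R]_n := [set p | forall i, `|p 0 i| <= L].
Definition sbox (L : R) : set (space R n) := [set p | vbox L p.1 /\ `|p.2| <= L].

End Euclid.

Section Domain.
Context (R : realType) (n : nat).

Definition Omega : set (space R n) := [set x | 0 < x.2].
Definition Omegabar : set (space R n) := [set x | 0 <= x.2].
Definition bdOmega : set (space R n) := [set x | x.2 = 0].

End Domain.

Section Functions.
Context {R : realType}.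

Definition modulus (w : R -> R) : Prop :=
  [/\ {within `[0, +oo[, continuous w},
      {in `[0, +oo[ &, {homo w : a b / a <= b}},
      (forall a, 0 <= a -> 0 <= w a) & w 0 = 0].

(* Only the restriction of f to D matters: the topology of [subspace D] is
   discrete outside D. *)
Definition lsc_on {E : topologicalType} (D : set E) (f : E -> R) : Prop :=
  lower_semicontinuous (fun X : subspace D => (f X)%:E).
Definition usc_on {E : topologicalType} (D : set E) (f : E -> R) : Prop :=
  lsc_on D (fun X => - f X).

Definition unif_continuous_on {E : uniformType} (D : set E) (f : E -> R) : Prop :=
  unif_continuous (f : subspace D -> R).

End Functions.

Section Viscosity.
Context {R : realType} {n : nat}.
Implicit Types (D S : set (spacetime R n)) (f u v : spacetime R n -> R).
Implicit Types K : spacetime R n -> space R n -> R.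

(* f is C^1 on D with gradient G = (f_t, (D'f, f_(x_d))), differentiability being
   relative to D, so that boundary points of D are allowed. The sets D used
   below are convex with nonempty interior, hence G is determined by f on D. *)
Definition C1_on D f (G : spacetime R n -> spacetime R n) : Prop :=
  {within D, continuous G} /\
  forall X, D X -> let D_X := within D (nbhs X) in
    (fun Y => f Y - f X - stdot (G X) (Y - X)) =o_D_X (fun Y => Y - X).

Definition touches_above D f u X : Prop :=
  f X = u X /\ \forall Y \near within D (nbhs X), u Y <= f Y.
Definition touches_below D f v X : Prop :=
  f X = v X /\ \forall Y \near within D (nbhs X), f Y <= v Y.

(* u_t + K(X, Du) <= 0 (resp. v_t + K(X, Dv) >= 0) at the points of S, in the
   viscosity sense, with test functions that are C^1 on D. *)
Definition visc_sub D S K u : Prop :=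
  forall f G X, C1_on D f G -> S X -> touches_above D f u X ->
    (G X).1 + K X (G X).2 <= 0.
Definition visc_super D S K v : Prop :=
  forall f G X, C1_on D f G -> S X -> touches_below D f v X ->
    0 <= (G X).1 + K X (G X).2.

End Viscosity.

Section Hamiltonians.
Context {R : realType} {n : nat}.
Implicit Types (A : set (spacetime R n)) (H F : spacetime R n -> space R n -> R).

Definition continuous_jointly A H : Prop :=
  {within A `*` [set: space R n], continuous (fun z => H z.1 z.2)}.

Definition loc_unif_continuous (wL : R -> R -> R) A H : Prop :=
  forall L : R, 0 < L -> forall X p q, A X -> sbox L p -> sbox L q ->
    `|H X p - H X q| <= wL L (snorm (p - q)).

Definition inf_on_box A H (L pd : R) : \bar R :=
  ereal_inf [set h | exists X p', [/\ A X, vbox L p' & h = (H X (p', pd))%:E]].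

Record condH (T : R) (w : R -> R) (wL : R -> R -> R) H : Prop := {
  H_continuous : continuous_jointly (`[0, T] `*` @Omegabar R n) H;
  H_bounded0 : [bounded H X 0 | X in `[0, T] `*` @Omegabar R n];
  H_unif : loc_unif_continuous wL (`[0, T] `*` @Omegabar R n) H;
  H_tangential : forall (t s : R) (x' y' : 'rV[R]_n) (xd : R) (p : space R n),
    t \in `[0, T] -> s \in `[0, T] -> 0 <= xd ->
    let X := (t, (x', xd)) in let Y := (s, (y', xd)) in
    H Y p - H X p <= w (stnorm (Y - X) * (1 + vnorm p.1 + Num.max 0 (H X p)));
  H_coercive : forall L : R, 0 < L ->
    (inf_on_box (`[0, T] `*` @Omegabar R n) H L pd @[pd --> +oo] --> +oo%E) /\
    (inf_on_box (`[0, T] `*` @Omegabar R n) H L pd @[pd --> -oo] --> +oo%E)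
}.

Record condF (T : R) (w : R -> R) (wL : R -> R -> R) H F : Prop := {
  F_continuous : continuous_jointly (`[0, T] `*` @bdOmega R n) F;
  F_bounded0 : [bounded F X 0 | X in `[0, T] `*` @bdOmega R n];
  F_nonincreasing : forall (X : spacetime R n) (p' : 'rV[R]_n), (`[0, T] `*` @bdOmega R n) X ->
    {homo (fun pd => F X (p', pd)) : a b /~ a <= b};
  F_unif : loc_unif_continuous wL (`[0, T] `*` @bdOmega R n) F;
  F_tangential : forall (X Y : spacetime R n) (p : space R n),
    (`[0, T] `*` @bdOmega R n) X -> (`[0, T] `*` @bdOmega R n) Y ->
    F Y p - F X p <=
      w (stnorm (Y - X) *
         (1 + vnorm p.1 + Num.max 0 (Num.max (F X p) (H X p))));
  F_semicoercive : forall L : R, 0 < L ->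
    inf_on_box (`[0, T] `*` @bdOmega R n) F L pd @[pd --> -oo] --> +oo%E
}.

End Hamiltonians.

(* Main.v *)
Require Import Defs.
From mathcomp Require Import ring lra.

(** Suppose that [u - v] has a positive supremum. Time and tangential variables
    are doubled with the penalty [k / 2 |X - Y|^2], the two points keeping the
    same normal coordinate, and a quadratic centred at an almost maximizer makes
    the supremum attained at some [(X0, Y0)], at the price of a perturbation of
    size [a] of one gradient. The normal coordinate is then doubled near
    [(X0, Y0)] with the extra penalty [p (x_d - y_d) + j / 2 (x_d - y_d)^2],
    [j -> +oo].

    Everything rests on the choice of [p]. The map
    [f q = (time slope) + F X0 (p', q)] is nonincreasing; take [f p = d / 2], or
    [p] beyond the coercivity threshold of [H] if [f] stays above [d / 2]. At the
    doubled maximum the normal slope [q] satisfies [q <= p] when [x_d = 0] and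
    [q >= p] when [y_d = 0]. So if [u] is tested at the boundary, [f q >= d / 2]
    rules out the [F] alternative: the [H] inequality holds for [u] in all cases,
    and the tangential regularity of [H] rules out the [H] inequality for [v].
    Hence [v] is tested at the boundary, where [f q <= d / 2] and the tangential
    regularity of [F] rule out the [F] alternative as well.

    The initial time is excluded by barriers which are uniform in space, obtained
    from the quadratic bound [u0 x - u0 y <= e + K |x - y|^2]. *)

Set Implicit Arguments.
Unset Strict Implicit.
Unset Printing Implicit Defensive.

(** * Euclidean products and norms *)

(** Squared norms serve as penalties: they are polynomial in the coordinates and expand exactly
    around any point. *)
Definition sq {R : realType} {n : nat} (X : spacetime R n) : R := stdot X X.
Definition ssq {R : realType} {n : nat} (x : space R n) : R := sdot x x.

Lemma vdotC (R : realType) n (x y : 'rV[R]_n) : vdot x y = vdot y x.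
Proof. by apply: eq_bigr => i _; rewrite mulrC. Qed.

Lemma vdotDl (R : realType) n (x y z : 'rV[R]_n) :
  vdot (x + y) z = vdot x z + vdot y z.
Proof. by rewrite -big_split; apply: eq_bigr => i _; rewrite mxE mulrDl. Qed.

Lemma vdotZl (R : realType) n (a : R) (x z : 'rV[R]_n) :
  vdot (a *: x) z = a * vdot x z.
Proof. by rewrite /vdot mulr_sumr; apply: eq_bigr => i _; rewrite mxE mulrA. Qed.

Lemma stdotC (R : realType) n (x y : spacetime R n) : stdot x y = stdot y x.
Proof. by rewrite /stdot /sdot vdotC mulrC [x.2.2 * _]mulrC. Qed.

Lemma stdotDl (R : realType) n (x y z : spacetime R n) :
  stdot (x + y) z = stdot x z + stdot y z.
Proof. rewrite /stdot /sdot /= vdotDl; ring. Qed.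

Lemma stdotZl (R : realType) n (a : R) (x z : spacetime R n) :
  stdot (a *: x) z = a * stdot x z.
Proof. rewrite /stdot /sdot /= vdotZl /GRing.scale /=; ring. Qed.

Lemma stdotNl (R : realType) n (x z : spacetime R n) :
  stdot (- x) z = - stdot x z.
Proof. by rewrite -scaleN1r stdotZl mulN1r. Qed.

Lemma sqD (R : realType) n (x y : spacetime R n) :
  sq (x + y) = sq x + 2 * stdot x y + sq y.
Proof.
rewrite /sq stdotDl stdotC stdotDl [stdot y (x + y)]stdotC stdotDl.
by rewrite [stdot y x]stdotC; ring.
Qed.

Lemma sqN (R : realType) n (x : spacetime R n) : sq (- x) = sq x.
Proof. by rewrite /sq stdotNl stdotC stdotNl opprK. Qed.

Lemma sqBC (R : realType) n (x y : spacetime R n) : sq (x - y) = sq (y - x).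
Proof. by rewrite -sqN opprB. Qed.

Lemma sqE (R : realType) n (x : spacetime R n) :
  sq x = x.1 ^+ 2 + (vdot x.2.1 x.2.1 + x.2.2 ^+ 2).
Proof. by rewrite /sq /stdot /sdot !expr2. Qed.

Lemma vdot_ge0 (R : realType) n (x : 'rV[R]_n) : 0 <= vdot x x.
Proof. by apply: sumr_ge0 => i _; rewrite -expr2 sqr_ge0. Qed.

Lemma ssq_ge0 (R : realType) n (x : space R n) : 0 <= ssq x.
Proof. by rewrite /ssq /sdot addr_ge0 ?vdot_ge0 // -expr2 sqr_ge0. Qed.

Lemma sq_ge0 (R : realType) n (x : spacetime R n) : 0 <= sq x.
Proof. by rewrite /sq /stdot addr_ge0 ?ssq_ge0 // -expr2 sqr_ge0. Qed.

Lemma le_coord_vdot (R : realType) n (x : 'rV[R]_n) i : x 0 i ^+ 2 <= vdot x x.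
Proof.
rewrite /vdot (bigD1 i) //= -expr2 lerDl.
by apply: sumr_ge0 => j _; rewrite -expr2 sqr_ge0.
Qed.

Lemma le_coord_mx_norm (R : realType) n (x : 'rV[R]_n) i : `|x 0 i| <= `|x|.
Proof.
by rewrite [leRHS]/Num.Def.normr /= mx_normrE; apply/bigmax_geP; right => /=; exists (0, i).
Qed.

Lemma vdot_le (R : realType) n (x : 'rV[R]_n) : vdot x x <= n%:R * `|x| ^+ 2.
Proof.
rewrite mulr_natl -[X in _ *+ X]card_ord -sumr_const.
apply: ler_sum => i _; rewrite -expr2 -real_normK ?num_real //.
by rewrite lerXn2r ?nnegrE // le_coord_mx_norm.
Qed.

Lemma norm_fst_le (R : realType) (U V : normedModType R) (x : U * V) : `|x.1| <= `|x|.
Proof. by rewrite [leRHS]/Num.Def.normr /= le_max lexx. Qed.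

Lemma norm_snd_le (R : realType) (U V : normedModType R) (x : U * V) : `|x.2| <= `|x|.
Proof. by rewrite [leRHS]/Num.Def.normr /= le_max lexx orbT. Qed.

Lemma ssq_le (R : realType) n (x : space R n) : ssq x <= n.+1%:R * `|x| ^+ 2.
Proof.
rewrite /ssq /sdot -natr1 mulrDl mul1r; apply: lerD.
  apply: (le_trans (vdot_le x.1)); rewrite ler_wpM2l // lerXn2r ?nnegrE //.
  exact: norm_fst_le.
by rewrite -expr2 -real_normK ?num_real // lerXn2r ?nnegrE // norm_snd_le.
Qed.

Lemma sq_le (R : realType) n (x : spacetime R n) : sq x <= n.+2%:R * `|x| ^+ 2.
Proof.
rewrite /sq /stdot -natr1 mulrDl mul1r addrC; apply: lerD.
  apply: (le_trans (ssq_le x.2)); rewrite ler_wpM2l // lerXn2r ?nnegrE //.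
  exact: norm_snd_le.
by rewrite -expr2 -real_normK ?num_real // lerXn2r ?nnegrE // norm_fst_le.
Qed.

Lemma vdot_continuous (R : realType) n : continuous (fun x : 'rV[R]_n => vdot x x).
Proof.
apply: continuous_big => [|i _ x]; first exact: add_continuous.
have H : {for x, continuous (fun x : 'rV[R]_n => x 0 i)} by exact: coord_continuous.
by apply: continuousM; exact: H.
Qed.

Lemma ssq_continuous (R : realType) n : continuous (@ssq R n).
Proof.
move=> x; apply: cvgD; last by apply: cvgM; exact: cvg_snd.
by apply: (@continuous_comp _ _ _ fst (fun x => vdot x x));
  [exact: cvg_fst|exact: vdot_continuous].
Qed.

Lemma sq_continuous (R : realType) n : continuous (@sq R n).
Proof.
move=> x; apply: cvgD; first by apply: cvgM; exact: cvg_fst.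
by apply: (@continuous_comp _ _ _ snd (@ssq R n));
  [exact: cvg_snd|exact: ssq_continuous].
Qed.

Lemma sqB_continuous (R : realType) n (X0 : spacetime R n) :
  continuous (fun X : spacetime R n => sq (X - X0)).
Proof.
move=> X; apply: (@continuous_comp _ _ _ (fun X : spacetime R n => X - X0) (@sq R n)).
  by apply: cvgB; [exact: cvg_id|exact: cvg_cst].
exact: sq_continuous.
Qed.

(** * Semicontinuity and compactness *)

(** Phrased with strict upper bounds and the relative neighbourhood filter, so that restriction,
    sums and composition need no subspace topology. *)
Definition usc_in {R : realType} {E : topologicalType} (A : set E) (f : E -> R) :=
  forall x, A x -> forall c, f x < c -> \forall y \near within A (nbhs x), f y < c.

Lemma lsc_on_usc (R : realType) (E : topologicalType) (D : set E) (f : E -> R) :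
  lsc_on D f -> usc_in D (fun x => - f x).
Proof.
move=> lf x Dx c fc; have /lf [V] : ((- c)%:E < (f x)%:E)%E by rewrite lte_fin ltrNl.
move=> Vx Vf; suff: within D (nbhs x) V.
  by apply: filterS => y Vy; have := Vf _ Vy; rewrite lte_fin ltrNl.
by rewrite nbhs_subspace_in.
Qed.

Lemma usc_on_usc (R : realType) (E : topologicalType) (D : set E) (f : E -> R) :
  usc_on D f -> usc_in D f.
Proof.
move=> /lsc_on_usc uf x Dx c; have := uf x Dx c; rewrite opprK.
by under eq_near do rewrite opprK.
Qed.

Lemma usc_in_sub (R : realType) (E : topologicalType) (A B : set E) (f : E -> R) :
  B `<=` A -> usc_in A f -> usc_in B f.
Proof.
move=> BA uf x Bx c fc; have := uf _ (BA _ Bx) _ fc; rewrite !near_withinE.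
by apply: filterS => y + By; apply; exact: BA.
Qed.

Lemma usc_in_comp (R : realType) (E E' : topologicalType) (A : set E) (B : set E')
    (f : E -> R) (g : E' -> E) :
  continuous g -> (forall y, B y -> A (g y)) -> usc_in A f -> usc_in B (f \o g).
Proof.
move=> cg BA uf y By c fc; have := uf _ (BA _ By) _ fc; rewrite !near_withinE => H.
have {}H : nbhs y (g @^-1` [set z | A z -> f z < c]) by exact: cg.
by apply: filterS H => z /= H Bz; apply: H; exact: BA.
Qed.

Lemma usc_inD (R : realType) (E : topologicalType) (A : set E) (f g : E -> R) :
  usc_in A f -> usc_in A g -> usc_in A (fun x => f x + g x).
Proof.
move=> uf ug x Ax c fgc; pose e := (c - f x - g x) / 2.
have e0 : 0 < e by rewrite /e; lra.
have fe : f x < f x + e by rewrite ltrDl.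
have ge : g x < g x + e by rewrite ltrDl.
apply: filterS2 (uf _ Ax _ fe) (ug _ Ax _ ge) => y; rewrite /e; lra.
Qed.

Lemma continuous_usc (R : realType) (E : topologicalType) (A : set E) (f : E -> R) :
  (forall x, A x -> {for x, continuous f}) -> usc_in A f.
Proof.
move=> cf x Ax c fc; rewrite near_withinE.
have H : nbhs x (f @^-1` [set z | z < c]) by apply: cf => //; exact: lt_nbhsl.
exact: filterS H.
Qed.

(** The sets of points of [A] where [f] is at least [f a] generate a proper filter, which clusters
    at some [x] by compactness. If [f x < f y], upper semicontinuity would separate [x] from the set
    attached to [y]. *)
Lemma usc_max (R : realType) (E : topologicalType) (A : set E) (f : E -> R) x0 :
  compact A -> A x0 -> usc_in A f -> exists2 x, A x & forall y, A y -> f y <= f x.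
Proof.
move=> cA Ax0 uf; pose G : set_system E :=
  filter_from A (fun a => [set y | A y /\ f a <= f y]).
have FG : ProperFilter G.
  apply: filter_from_proper; last by move=> a Aa; exists a; split.
  apply: filter_from_filter; first by exists x0.
  move=> a b Aa Ab; case: (leP (f a) (f b)) => ab.
    by exists b => // y [Ay by_]; do 2 split => //; apply: le_trans by_.
  by exists a => // y [Ay ay]; do 2 split => //; apply: le_trans ay; exact: ltW.
have GA : G A by exists x0 => // y [].
have [x [Ax clx]] := cA _ FG GA.
exists x => // y Ay; rewrite leNgt; apply/negP => /(uf _ Ax); rewrite near_withinE => H.
have Gy : G [set z | A z /\ f y <= f z] by exists y.
have [z [[Az yz] /(_ Az)]] := clx _ _ Gy H.
by rewrite ltNge yz.
Qed.

Lemma compact_sq_ball (R : realType) n (X0 : spacetime R n) (M : R) :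
  compact [set X | sq (X - X0) <= M].
Proof.
(* The half-width [1 + M] avoids a square root: b^2 <= M forces |b| <= 1 + M. *)
pose J (a : R) := `[a - (1 + M), a + (1 + M)]%classic.
pose B : set (spacetime R n) :=
  J X0.1 `*` ([set v : 'rV[R]_n | forall i, J (X0.2.1 0 i) (v 0 i)] `*` J X0.2.2).
apply: (@subclosed_compact _ _ B).
- have : closed ((fun X : spacetime R n => sq (X - X0)) @^-1` [set x : R | x <= M]).
    apply: preimage_closed; last exact: closed_le.
    by move=> X _; exact: sqB_continuous.
  by [].
- apply: compact_setX; first exact: segment_compact.
  apply: compact_setX; last exact: segment_compact.
  by apply: (rV_compact (A := fun i => J (X0.2.1 0 i))) => i; exact: segment_compact.
move=> X /=; rewrite sqE /= => XM.
have v0 := vdot_ge0 (X.2.1 - X0.2.1); have s1 := sqr_ge0 (X.1 - X0.1).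
have s2 := sqr_ge0 (X.2.2 - X0.2.2).
have aux (a b : R) : (a - b) ^+ 2 <= M -> J b a.
  rewrite /J /= in_itv /= => abM; apply/andP; split; nra.
split; first by apply: aux; lra.
split => /=; last by apply: aux; lra.
move=> i; apply: aux; have := le_coord_vdot (X.2.1 - X0.2.1) i; rewrite !mxE; lra.
Qed.

(** * Quadratic test functions *)

(** [G] is a proximal supergradient of [f] at [X] relative to [D]. The constant is left free, so
    that such relations add up without tracking second-order terms. *)
Definition parab_above {R : realType} {n : nat} (D : set (spacetime R n))
    (f : spacetime R n -> R) (X G : spacetime R n) :=
  exists C, \forall Y \near within D (nbhs X),
    f Y <= f X + stdot G (Y - X) + C * sq (Y - X).

(* [v] is a supersolution for [K] when [- v] is a subsolution for
   [fun X p => - K X (- p)]; only quadratic test functions are used. *)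
Definition psub {R : realType} {n : nat} (D S : set (spacetime R n))
    (K : spacetime R n -> space R n -> R) (u : spacetime R n -> R) :=
  forall X G, S X -> parab_above D u X G -> G.1 + K X G.2 <= 0.

Lemma stdot0 (R : realType) n (X : spacetime R n) : stdot X 0 = 0.
Proof. by rewrite stdotC -(scale0r X) stdotZl mul0r. Qed.

(** Expanding around [X0] leaves exactly the remainder C |Y - X0|^2, which is quadratic and hence
    negligible. *)
Lemma C1_quadratic (R : realType) n (D : set (spacetime R n)) (X G : spacetime R n)
    (a C : R) :
  C1_on D (fun Y => a + stdot G (Y - X) + C * sq (Y - X))
          (fun Y => G + (2 * C) *: (Y - X)).
Proof.
split.
  apply: continuous_subspaceT => Y; apply: cvgD; first exact: cvg_cst.
  by apply: cvgZr; apply: cvgB; [exact: cvg_id|exact: cvg_cst].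
move=> X0 DX0 /=; apply/eqoP => e e0 /=.
(* The summand 1 keeps [M] positive when [C] is 0. *)
pose M := n.+2%:R * `|C| + 1; have M0 : 0 < M by rewrite ltr_wpDl // mulr_ge0.
have : \forall Y \near within D (nbhs X0), `|Y - X0| < e / M.
  rewrite near_withinE; near=> Y => _; rewrite distrC; near: Y.
  by apply: cvgr_dist_lt; [exact: cvg_id|exact: divr_gt0].
apply: filterS => Y YX.
have -> : a + stdot G (Y - X) + C * sq (Y - X) -
    (a + stdot G (X0 - X) + C * sq (X0 - X)) -
    stdot (G + (2 * C) *: (X0 - X)) (Y - X0) = C * sq (Y - X0).
  have -> : Y - X = (X0 - X) + (Y - X0) by rewrite [RHS]addrC subrKA.
  rewrite sqD [stdot (G + _) _]stdotDl stdotZl [stdot G (X0 - X + _)]stdotC.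
  rewrite [stdot (X0 - X + _) _]stdotDl.
  rewrite [stdot (X0 - X) G]stdotC [stdot (Y - X0) G]stdotC; ring.
rewrite normrM [`|sq _|]ger0_norm ?sq_ge0 //.
apply: le_trans (ler_wpM2l (normr_ge0 C) (sq_le _)) _.
rewrite expr2 !mulrA ler_wpM2r //.
apply: (@le_trans _ _ (M * `|Y - X0|)).
  by rewrite ler_wpM2r // [_ * n.+2%:R]mulrC /M lerDl.
by rewrite mulrC -ler_pdivlMr // ltW.
Unshelve. all: by end_near.
Qed.

Lemma visc_sub_psub (R : realType) n (D S : set (spacetime R n)) K u :
  S `<=` D -> visc_sub D S K u -> psub D S K u.
Proof.
move=> SD vu X G SX [C uC].
have := vu _ _ X (C1_quadratic D X G (u X) C) SX; rewrite subrr scaler0 addr0; apply.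
split; last exact: uC.
by rewrite subrr /sq !stdot0 mulr0 !addr0.
Qed.

Lemma visc_super_psub (R : realType) n (D S : set (spacetime R n)) K v :
  S `<=` D -> visc_super D S K v ->
  psub D S (fun X p => - K X (- p)) (fun X => - v X).
Proof.
move=> SD vv X G SX [C vC].
have := vv _ _ X (C1_quadratic D X (- G) (v X) (- C)) SX.
rewrite subrr scaler0 addr0 -oppr_le0 opprD opprK; apply.
split; first by rewrite subrr /sq !stdot0 mulr0 !addr0.
apply: filterS vC => Y; rewrite stdotNl; lra.
Qed.

Lemma parab_aboveD (R : realType) n (D : set (spacetime R n)) f g X G G' :
  parab_above D f X G -> parab_above D g X G' ->
  parab_above D (fun Y => f Y + g Y) X (G + G').
Proof.
move=> [C fC] [C' gC]; exists (C + C'); apply: filterS2 fC gC => Y.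
rewrite stdotDl; lra.
Qed.

Lemma parab_above_sq (R : realType) n (D : set (spacetime R n)) X X0 a :
  parab_above D (fun Y => a * sq (Y - X0)) X ((2 * a) *: (X - X0)).
Proof.
exists a; apply: nearW => Y.
have -> : Y - X0 = (X - X0) + (Y - X) by rewrite [RHS]addrC subrKA.
rewrite sqD stdotZl; lra.
Qed.

Lemma parab_above_time (R : realType) n (D : set (spacetime R n)) X a :
  parab_above D (fun Y => a * Y.1) X (a, 0).
Proof.
exists 0; apply: nearW => Y; rewrite /stdot /= /sdot /vdot /= big1 => [|i _].
  rewrite mul0r; lra.
by rewrite mxE mul0r.
Qed.

Lemma parab_above_inv (R : realType) n (D : set (spacetime R n)) (X : spacetime R n) T a :
  X.1 < T -> 0 <= a ->
  parab_above D (fun Y => a / (T - Y.1)) X (a / (T - X.1) ^+ 2, 0).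
Proof.
move=> XT a0; pose s := T - X.1; have s0 : 0 < s by rewrite subr_gt0.
(* With r = T - Y.1, the exact remainder of a / r is a (s - r)^2 / (r s^2), and r > s / 2 close to
   [X]. *)
exists (2 * a / s ^+ 3).
have : \forall Y \near within D (nbhs X), T - Y.1 > s / 2.
  rewrite near_withinE; near=> Y => _; near: Y.
  apply: (@cvgr_gt _ _ _ _ (fun Y : spacetime R n => T - Y.1) s); last by lra.
  by apply: cvgB; [exact: cvg_cst|exact: cvg_fst].
apply: filterS => Y Ys; set r := T - Y.1 in Ys *.
have r0 : 0 < r by lra.
have -> : stdot (a / (T - X.1) ^+ 2, 0) (Y - X) = a / s ^+ 2 * (s - r).
  rewrite /stdot /= /sdot /vdot /= big1 => [|i _]; last by rewrite mxE mul0r.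
  rewrite /s /r; ring.
have -> : a / (T - X.1) = a / s by [].
have e : a / r = a / s + a / s ^+ 2 * (s - r) + a * (s - r) ^+ 2 / (r * s ^+ 2).
  by field; rewrite !gt_eqF.
rewrite e lerD2l.
have : (s - r) ^+ 2 <= sq (Y - X).
  have := sqE (Y - X); have := vdot_ge0 (Y - X).2.1; have := sqr_ge0 (Y - X).2.2.
  have -> : s - r = (Y - X).1 by rewrite /s /r /=; ring.
  lra.
have : (r * s ^+ 2)^-1 <= 2 / s ^+ 3.
  rewrite exprS; have q0 : 0 < s ^+ 2 by exact: exprn_gt0.
  rewrite ler_pdivlMr ?mulr_gt0 // mulrC ler_pdivrMr ?mulr_gt0 //.
  have : 0 <= (2 * r - s) * s ^+ 2 by rewrite mulr_ge0 ?ltW //; lra.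
  lra.
have : 0 <= (r * s ^+ 2)^-1 by rewrite invr_ge0 mulr_ge0 ?sqr_ge0 // ltW.
have := sqr_ge0 (s - r); move: (_ ^-1) (_ ^+ 2) (sq _) => b c d c0 b0 bs cd.
rewrite -mulrA -[2 * a / _]mulrA [2 * (a / _)]mulrCA -[a * _ * d]mulrA ler_wpM2l //.
by rewrite mulrC ler_pM.
Unshelve. all: by end_near.
Qed.

(** This is how gradients are read off from a local maximum of [f - g], with [g] an explicit
    penalty. *)
Lemma parab_above_max (R : realType) n (D : set (spacetime R n)) f g X G :
  (\forall Y \near within D (nbhs X), f Y - g Y <= f X - g X) ->
  parab_above D g X G -> parab_above D f X G.
Proof. move=> fg [C gC]; exists C; apply: filterS2 fg gC => Y; lra. Qed.

(** * Moduli and penalization *)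

Lemma norm_le_ssq (R : realType) n (x : space R n) : `|x| ^+ 2 <= ssq x.
Proof.
have v0 := vdot_ge0 x.1; have s0 := sqr_ge0 x.2.
have -> : `|x| = Num.max `|x.1| `|x.2| by [].
have e : ssq x = vdot x.1 x.1 + x.2 ^+ 2 by rewrite /ssq /sdot expr2.
case: (leP `|x.1| `|x.2|) => _; first by rewrite real_normK ?num_real // e; lra.
have [-> | [i ->]] : `|x.1| = 0 \/ exists i, `|x.1| = `|x.1 0 i|.
- have [z|/mx_norm_neq0 [[a i] /= ai]] := eqVneq (mx_norm x.1) 0.
    by left.
  by right; exists i; rewrite ord1 in ai.
- by rewrite expr0n /= e; lra.
- by rewrite real_normK ?num_real // e; have := le_coord_vdot x.1 i; lra.
Qed.

Lemma norm_le_sq (R : realType) n (x : spacetime R n) : `|x| ^+ 2 <= sq x.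
Proof.
have e : sq x = x.1 ^+ 2 + ssq x.2 by rewrite /sq /stdot expr2.
have -> : `|x| = Num.max `|x.1| `|x.2| by [].
have h1 := norm_le_ssq x.2; have h2 := ssq_ge0 x.2; have h3 := sqr_ge0 x.1.
case: (leP `|x.1| `|x.2|) => _; first by rewrite e; lra.
by rewrite real_normK ?num_real // e; lra.
Qed.

(** A segment of the convex set [Omegabar] is cut into pieces shorter than [rho], each costing at
    most [k]. The first piece gives the constant term; the number of the others is at most |x - y|^2
    / rho^2. *)
Lemma unif_continuous_quadratic (R : realType) n (f : space R n -> R) :
  unif_continuous_on (@Omegabar R n) f ->
  forall k, 0 < k -> exists2 K, 0 <= K & forall x y, Omegabar x -> Omegabar y ->
    f x - f y <= k + K * ssq (x - y).
Proof.
move=> uf k k0.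
have [rho rho0 frho] : exists2 rho, 0 < rho & forall x y, Omegabar x -> Omegabar y ->
    `|x - y| < rho -> f x - f y <= k.
  have : nbhs entourage [set xy : R * R | ball xy.1 k xy.2].
    by rewrite nbhs_simpl -entourage_ballE; exists k.
  move=> /uf; rewrite nbhs_simpl /=.
  move=> [W]; rewrite -entourage_ballE => -[rho /= rho0 rW Wf].
  exists rho => // x y xO yO xy.
  have : ball (f x) k (f y).
    apply: (Wf (x, y)); right; split => //; split => //; apply: rW.
    by rewrite /= -ball_normE.
  by rewrite -ball_normE /= => h; apply: le_trans (ler_norm _) (ltW h).
have chain N : forall x y, Omegabar x -> Omegabar y -> `|x - y| < N.+1%:R * rho ->
    f x - f y <= N.+1%:R * k.
  elim: N => [|N IH] x y xO yO xy; first by rewrite mul1r; apply: frho; rewrite // mul1r in xy.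
  pose a : R := N.+2%:R^-1; have a0 : 0 < a by rewrite invr_gt0.
  have a1 : a <= 1 by rewrite invf_le1 // ler1n.
  have aN : a * N.+2%:R = 1 by rewrite mulVf.
  have aN1 : 1 - a = a * N.+1%:R by move: aN; rewrite -[N.+2%:R]natr1; lra.
  pose z := x + a *: (y - x).
  have zO : Omegabar z.
    rewrite /Omegabar /= /GRing.scale /= in xO yO *.
    have -> : x.2 + a * (y.2 - x.2) = a * y.2 + (1 - a) * x.2 by ring.
    by rewrite addr_ge0 // mulr_ge0 ?subr_ge0 // ltW.
  have xz : `|x - z| < rho.
    have -> : x - z = a *: (x - y) by rewrite /z opprD addNKr -scalerN opprB.
    rewrite normrZ gtr0_norm // mulrC -ltr_pdivlMr // /a invrK mulrC; exact: xy.
  have zy : `|z - y| < N.+1%:R * rho.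
    have -> : z - y = (1 - a) *: (x - y).
      by rewrite /z scalerBl scale1r -scalerN opprB addrAC.
    rewrite normrZ aN1 normrM !ger0_norm ?ltW // -mulrA mulrCA ltr_pM2l //.
    rewrite mulrC -ltr_pdivlMr // /a invrK mulrC; exact: xy.
  have := frho _ _ xO zO xz; have := IH _ _ zO yO zy.
  rewrite -[N.+2%:R]natr1 mulrDl mul1r; lra.
exists (k / rho ^+ 2); first by rewrite divr_ge0 ?sqr_ge0 // ltW.
move=> x y xO yO; pose r := `|x - y| / rho; have r0 : 0 <= r by rewrite divr_ge0 // ltW.
have /andP [Nr rN] := Num.Theory.truncn_itv r0; set N := Num.truncn r in Nr rN.
have xyN : `|x - y| < N.+1%:R * rho by rewrite -ltr_pdivrMr.
apply: le_trans (chain N _ _ xO yO xyN) _.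
rewrite -natr1 mulrDl mul1r addrC lerD2l.
apply: (@le_trans _ _ (k * r ^+ 2)).
  rewrite mulrC ler_pM2l //.
  (* For a natural number, N <= N^2 <= r^2. *)
  case: N Nr {rN xyN} => [|N] Nr; first by rewrite mulr0n sqr_ge0.
  have : 1 <= N.+1%:R :> R by rewrite ler1n.
  by move: N.+1%:R Nr => b; nra.
rewrite /r expr_div_n mulrA -mulrAC ler_wpM2l ?norm_le_ssq //.
by rewrite divr_ge0 ?sqr_ge0 // ltW.
Qed.

Lemma modulus_small (R : realType) (w : R -> R) : modulus w ->
  forall e, 0 < e -> exists2 r, 0 < r & forall a, 0 <= a -> a <= r -> w a <= e.
Proof.
move=> [cw iw pw w0] e e0.
have /continuous_within_itvcyP [_ cw0] := cw.
have : \forall a \near 0^'+, w a < e.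
  by apply: (cvgr_lt (w 0)); [exact: cw0|rewrite w0].
rewrite near_withinE => -[r /= r0 rw]; exists (r / 2); first by rewrite divr_gt0.
move=> a; rewrite le_eqVlt => /predU1P [<- _|a0 ar]; first by rewrite w0 ltW.
apply/ltW/rw => //=; rewrite sub0r normrN gtr0_norm //; lra.
Qed.

(* The suprema of [f - k g] are nonincreasing in [k], hence almost equal at [k]
   and [k / 2] for large [k]; compare them at an almost maximizer. *)
Lemma penalization (R : realType) (T : Type) (B : set T) (f g : T -> R) (k0 c : R) Z0 :
  0 < k0 -> B Z0 -> g Z0 = 0 -> (forall Z, B Z -> 0 <= g Z) ->
  (forall k Z, k0 <= k -> B Z -> f Z - k * g Z <= c) ->
  forall t, 0 < t -> exists2 k1, k0 <= k1 & forall k, k1 <= k -> forall Z, B Z ->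
    (forall Z', B Z' -> f Z' - k * g Z' <= f Z - k * g Z + t) -> k * g Z <= 4 * t.
Proof.
move=> k00 BZ0 gZ0 g0 fc t t0.
pose S k := [set f Z - k * g Z | Z in B]; pose M k := sup (S k).
have hS k : k0 <= k -> has_sup (S k).
  move=> kk; split; first by exists (f Z0 - k * g Z0); exists Z0.
  by exists c => _ [Z BZ <-]; exact: fc.
have MZ k Z : k0 <= k -> B Z -> f Z - k * g Z <= M k.
  by move=> kk BZ; apply: ub_le_sup; [exact: (hS _ kk).2|exists Z].
pose I := [set M k | k in [set k | k0 <= k]].
have hI : has_inf I.
  split; first by exists (M k0), k0 => /=.
  exists (f Z0) => _ [k /= kk <-]; have := MZ _ _ kk BZ0; rewrite gZ0; lra.
have [_ [k1 /= kk1 <-] Mk1] := inf_adherent t0 hI.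
exists (2 * k1); first by lra.
move=> k kk Z BZ Zmax.
have k2 : k1 <= k / 2 by lra.
(* Together with [Mk1], the bounds [a1], [a2] and [a3] give (k - k1) g Z <= 2 t; since k1 <= k / 2,
   this yields k g Z <= 4 t. *)
have a1 : M k <= f Z - k * g Z + t.
  apply: ge_sup; first by exists (f Z0 - k * g Z0); exists Z0.
  by move=> _ [Z' BZ' <-]; exact: Zmax.
have a2 : f Z - k1 * g Z <= M k1 by exact: MZ.
have a3 : inf I <= M k by apply: ge_inf; [exact: hI.2|exists k => //=; lra].
have := g0 _ BZ; have : 0 <= (k / 2 - k1) * g Z by rewrite mulr_ge0 ?subr_ge0 ?g0.
lra.
Qed.

(** * Doubling the normal coordinate *)

(** Joint continuity combined with the near-covering form of compactness. Uniformity in [p] is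
    needed because the normal slope at the doubled maximum is only known to lie in a segment fixed
    beforehand. *)
Lemma near_uniform_on_compact (R : realType) n (A : set (spacetime R n)) H
    (X0 : spacetime R n) (P : set (space R n)) (e : R) :
  continuous_jointly A H -> A X0 -> compact P -> 0 < e ->
  \forall X \near X0 & z \near (0 : space R n),
    A X -> forall p, P p -> `|H X (p + z) - H X0 p| < e.
Proof.
move=> cH AX0 cP e0; have e20 : 0 < e / 2 by rewrite divr_gt0.
pose Q (Xz : spacetime R n * space R n) (p : space R n) :=
  A Xz.1 -> `|H Xz.1 (p + Xz.2) - H X0 p| < e.
suff : \forall Xz \near nbhs (X0, (0 : space R n)), P `<=` Q Xz.
  by apply: filterS => -[X z] PQ /= AX p Pp; exact: (PQ p Pp).
move/compact_near_coveringP : cP; apply => p Pp.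
have Hp : \forall Z \near (X0, p), A Z.1 -> `|H Z.1 Z.2 - H X0 p| < e / 2.
  have AXp : (A `*` [set: space R n]) (X0, p) by [].
  have /subspace_continuousP /(_ _ AXp) /cvgrPdist_lt /(_ _ e20) := cH.
  rewrite near_withinE; apply: filterS => -[X q] /= h AX.
  by rewrite distrC; apply: h.
pose g1 (w : space R n * (spacetime R n * space R n)) := (w.2.1, w.1 + w.2.2).
pose g2 (w : space R n * (spacetime R n * space R n)) := (X0, w.1).
have c1 : g1 w @[w --> (p, (X0, (0 : space R n)))] --> (X0, p).
  apply: (@cvg_pair _ _ _ _ (nbhs X0) (nbhs p)); first exact: (cvg_comp _ _ cvg_snd cvg_fst).
  by rewrite -[p in X in _ `=>` X]addr0; apply: cvgD; [exact: cvg_fst|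
    exact: (cvg_comp _ _ cvg_snd cvg_snd)].
have c2 : g2 w @[w --> (p, (X0, (0 : space R n)))] --> (X0, p).
  by apply: (@cvg_pair _ _ _ _ (nbhs X0) (nbhs p)); [exact: cvg_cst|exact: cvg_fst].
have h1 : \forall w \near (p, (X0, (0 : space R n))),
    A (g1 w).1 -> `|H (g1 w).1 (g1 w).2 - H X0 p| < e / 2 := c1 _ Hp.
have h2 : \forall w \near (p, (X0, (0 : space R n))),
    A (g2 w).1 -> `|H (g2 w).1 (g2 w).2 - H X0 p| < e / 2 := c2 _ Hp.
suff : \forall w \near (p, (X0, (0 : space R n))), Q w.2 w.1 by [].
move: h1 h2; apply: filterS2 => -[q [X z]] /= h1 h2 AX.
have := h1 AX; have := h2 AX0.
rewrite [`|H X0 q - _|]distrC => a b.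
have := ler_distD (H X0 p) (H X (q + z)) (H X0 q); rewrite /=; lra.
Qed.

Lemma continuous_jointly_gradient (R : realType) n (A : set (spacetime R n)) H X0 :
  continuous_jointly A H -> A X0 -> continuous (H X0).
Proof.
move=> cH AX0 p; apply/cvgrPdist_lt => e e0.
have AXp : (A `*` [set: space R n]) (X0, p) by [].
have /subspace_continuousP /(_ _ AXp) /cvgrPdist_lt /(_ _ e0) := cH.
rewrite near_withinE => Hp.
have c : (X0, q) @[q --> p] --> (X0, p).
  by apply: (@cvg_pair _ _ _ _ (nbhs X0) (nbhs p)); [exact: cvg_cst|exact: cvg_id].
have : \forall q \near p, (A `*` [set: space R n]) (X0, q) -> `|H X0 p - H X0 q| < e := c _ Hp.
by apply: filterS => q; apply.
Qed.

Lemma parab_above_normal (R : realType) n (D : set (spacetime R n)) (X : spacetime R n) a b c :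
  0 <= b ->
  parab_above D (fun Y => a * Y.2.2 + b * (Y.2.2 - c) ^+ 2) X
    (0, (0, a + 2 * b * (X.2.2 - c))).
Proof.
move=> b0; exists b; apply: nearW => Y.
have -> : stdot (0, (0, a + 2 * b * (X.2.2 - c))) (Y - X) =
    (a + 2 * b * (X.2.2 - c)) * (Y.2.2 - X.2.2).
  rewrite /stdot /sdot /vdot /= big1 ?mul0r ?add0r // => i _.
  by rewrite mxE mul0r.
have := sqE (Y - X); have := vdot_ge0 (Y - X).2.1; have := sqr_ge0 (Y - X).1.
move=> h1 h2 h3; have : (Y.2.2 - X.2.2) ^+ 2 <= sq (Y - X).
  by rewrite h3 /= in h1 h2 *; lra.
move: (sq _) => s ys; have : 0 <= b * (s - (Y.2.2 - X.2.2) ^+ 2) by rewrite mulr_ge0 ?subr_ge0.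
lra.
Qed.

Lemma compact_half_ball (R : realType) n (X0 : spacetime R n) r :
  compact [set X : spacetime R n | sq (X - X0) <= r /\ 0 <= X.2.2].
Proof.
apply: compact_closedI; first exact: compact_sq_ball.
have : closed ((fun X : spacetime R n => X.2.2) @^-1` [set x : R | 0 <= x]).
  apply: preimage_closed; last exact: closed_ge.
  by move=> X _; exact: (cvg_comp _ _ cvg_snd cvg_snd).
by [].
Qed.

Definition interior_times (R : realType) n (T : R) : set (spacetime R n) :=
  `]0, T[ `*` @Omegabar R n.
Arguments interior_times {R n} T.

Lemma half_ball_sub (R : realType) n (T : R) (X0 : spacetime R n) : interior_times T X0 ->
  exists2 r, 0 < r & [set X : spacetime R n | sq (X - X0) <= r /\ 0 <= X.2.2] `<=` interior_times T.
Proof.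
move=> [/= + X0O]; rewrite in_itv /= => /andP [t0 tT].
pose m := Num.min X0.1 (T - X0.1) / 2.
have [m0 m1 m2] : [/\ 0 < m, m < X0.1 & m < T - X0.1].
  by rewrite /m; case: (leP X0.1 (T - X0.1)) => h; split; lra.
exists (m ^+ 2); first exact: exprn_gt0.
move=> X [/= Xm Xd]; split => //=; rewrite in_itv /=.
have := sqE (X - X0); have := vdot_ge0 (X - X0).2.1; have := sqr_ge0 (X - X0).2.2.
rewrite /= => h1 h2 h3; have {h1 h2 h3} : (X.1 - X0.1) ^+ 2 <= m ^+ 2 by lra.
move=> h; apply/andP; split; nra.
Qed.

Lemma normal_gap_continuous (R : realType) n :
  continuous (fun Z : spacetime R n * spacetime R n => Z.1.2.2 - Z.2.2.2).
Proof.
by move=> Z; apply: cvgB;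
  [apply: (cvg_comp _ _ (cvg_comp _ _ cvg_fst cvg_snd) cvg_snd)|
   apply: (cvg_comp _ _ (cvg_comp _ _ cvg_snd cvg_snd) cvg_snd)].
Qed.

(* A cluster point of penalized maximizers lies in [g = 0] and maximizes there. *)
Lemma penalized_maximizer_near (R : realType) (E : topologicalType) (K : set E)
    (f g : E -> R) (p : R) (z0 : E) (N : set E) :
  compact K -> usc_in K f -> continuous g -> K z0 -> g z0 = 0 ->
  (forall z, K z -> g z = 0 -> f z0 <= f z -> z = z0) -> nbhs z0 N ->
  exists (j : R) (z : E), [/\ 0 <= j, K z, N z & forall y, K y ->
    f y - p * g y - j * g y ^+ 2 <= f z - p * g z - j * g z ^+ 2].
Proof.
move=> cK uf cg Kz0 gz0 z0uniq Nz0.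
pose psi (j : R) z := f z - p * g z - j * g z ^+ 2.
have upsi j : usc_in K (psi j).
  apply: usc_inD; first apply: usc_inD => //.
    by apply: continuous_usc => x _; apply: cvgN; apply: cvgM; [exact: cvg_cst|exact: cg].
  apply: continuous_usc => x _; apply: cvgN; apply: cvgM; first exact: cvg_cst.
  by apply: cvgM; exact: cg.
have /choice [z_ z_max] : forall j : nat, exists z,
    K z /\ forall y, K y -> psi j%:R y <= psi j%:R z.
  by move=> j; have [z Kz zm] := usc_max cK Kz0 (upsi j%:R); exists z.
have z_ge (j : nat) : f z0 <= psi j%:R (z_ j).
  by have := (z_max j).2 _ Kz0; rewrite {1}/psi gz0 expr0n /= !mulr0 !subr0.
have FK : \forall j \near \oo, K (z_ j) by apply: nearW => j; have [] := z_max j.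
have [z [Kz clz]] := cK (z_ @ \oo) _ FK.
have cluster_ge (J : nat) (B : set E) : nbhs z B -> exists2 j, (J <= j)%N & B (z_ j).
  move=> zB; have FJ : (z_ @ \oo) [set z_ j | j in [set j | (J <= j)%N]].
    by exists J => // j /= Jj; exists j.
  by have [_ [[j /= Jj <-] Bj]] := clz _ _ FJ zB; exists j.
have psi_eq (j : nat) : psi j%:R (z_ j) = psi 0 (z_ j) - j%:R * g (z_ j) ^+ 2.
  by rewrite /psi mul0r subr0.
have gz : g z = 0.
  apply/eqP/negPn/negP => gz_neq.
  have gz2 : 0 < g z ^+ 2 by rewrite exprn_even_gt0.
  (* As [z_ 0] maximizes [psi 0], the bound [z_ge] gives j g(z_j)^2 <= S for every j. Past the index
     [J] this contradicts g^2 > g(z)^2 / 2 near [z]. *)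
  pose S := psi 0 (z_ 0%N) - f z0.
  pose J := (Num.truncn (2 * S / g z ^+ 2)).+1.
  have HJ : S < J%:R * (g z ^+ 2 / 2).
    have := truncnS_gt (2 * S / g z ^+ 2); rewrite ltr_pdivrMr // /J; lra.
  have : nbhs z [set y | g z ^+ 2 / 2 < g y ^+ 2].
    have cgz : g y ^+ 2 @[y --> z] --> g z ^+ 2 by apply: cvgM; exact: cg.
    by apply: (cvgr_gt _ cgz); lra.
  move=> /(cluster_ge J) [j Jj /= gj].
  have := z_ge j; rewrite psi_eq; have := (z_max 0%N).2 _ (z_max j).1.
  have : J%:R <= j%:R :> R by rewrite ler_nat.
  have : 0 <= J%:R :> R by [].
  move: HJ gj gz2; rewrite /S; move: (g z ^+ 2) (g _ ^+ 2) (J%:R) (j%:R) => a b c d.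
  nra.
have fz : f z0 <= f z.
  rewrite leNgt; apply/negP => fz.
  have : psi 0 z < f z0 by rewrite /psi gz mulr0 mul0r !subr0.
  move=> /(upsi 0 _ Kz); rewrite near_withinE => /(cluster_ge 0%N) [j _ /(_ (z_max j).1)].
  have := z_ge j; rewrite psi_eq; have : 0 <= j%:R * g (z_ j) ^+ 2 by rewrite mulr_ge0 ?sqr_ge0.
  lra.
move: Nz0; rewrite -(z0uniq _ Kz gz fz) => /(cluster_ge 0%N) [j _ Nj].
by exists j%:R, (z_ j); split => //; [exact: (z_max j).1|exact: (z_max j).2].
Unshelve. all: by end_near.
Qed.

(** Adding the penalties [sq (X - X0)] and [sq (Y - Y0)] makes [(X0, Y0)] the only maximizer at
    equal depth on a product of compact half-balls. Maximizers for a strong penalty on the depth gap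
    therefore come into [N], and the linear penalty with coefficient [p] fixes the base value of the
    normal slope. *)
Lemma normal_doubling (R : realType) n (T k p : R) (u v : spacetime R n -> R) X0 Y0
    (N : set (spacetime R n * spacetime R n)) :
  0 <= k -> usc_in (interior_times T) u -> usc_in (interior_times T) v ->
  interior_times T X0 -> interior_times T Y0 -> X0.2.2 = Y0.2.2 ->
  (forall X Y, interior_times T X -> interior_times T Y -> X.2.2 = Y.2.2 ->
    u X + v Y - k / 2 * sq (X - Y) <= u X0 + v Y0 - k / 2 * sq (X0 - Y0)) ->
  nbhs (X0, Y0) N ->
  exists (X Y : spacetime R n) (j : R), [/\ N (X, Y), interior_times T X, interior_times T Y,
    0 <= j & let s := p + j * (X.2.2 - Y.2.2) in
    parab_above (interior_times T) u X (k *: (X - Y) + 2 *: (X - X0) + (0, (0, s))) /\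
    parab_above (interior_times T) v Y (k *: (Y - X) + 2 *: (Y - Y0) - (0, (0, s)))].
Proof.
move=> k0 uu uv DX0 DY0 XY0 hmax NXY.
have [r1 r10 B1D] := half_ball_sub DX0; have [r2 r20 B2D] := half_ball_sub DY0.
set B1 := [set X | _] in B1D; set B2 := [set X | _] in B2D.
pose K := B1 `*` B2.
have cK : compact K by apply: compact_setX; exact: compact_half_ball.
pose f (Z : spacetime R n * spacetime R n) :=
  u Z.1 + v Z.2 - k / 2 * sq (Z.1 - Z.2) - sq (Z.1 - X0) - sq (Z.2 - Y0).
pose g (Z : spacetime R n * spacetime R n) := Z.1.2.2 - Z.2.2.2.
have sq0 : sq (0 : spacetime R n) = 0 by rewrite /sq stdot0.
have csqX : continuous (fun Z : spacetime R n * spacetime R n => sq (Z.1 - X0)).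
  move=> Z; apply: (@continuous_comp _ _ _ fst (fun X : spacetime R n => sq (X - X0))).
    exact: cvg_fst.
  exact: sqB_continuous.
have csqY : continuous (fun Z : spacetime R n * spacetime R n => sq (Z.2 - Y0)).
  move=> Z; apply: (@continuous_comp _ _ _ snd (fun X : spacetime R n => sq (X - Y0))).
    exact: cvg_snd.
  exact: sqB_continuous.
have uf : usc_in K f.
  have cfst : continuous (fst : spacetime R n * spacetime R n -> _) by move=> Z; exact: cvg_fst.
  have csnd : continuous (snd : spacetime R n * spacetime R n -> _) by move=> Z; exact: cvg_snd.
  apply: usc_inD; [apply: usc_inD; [apply: usc_inD; [apply: usc_inD|]|]|].
  - by apply: (usc_in_comp (f := u) cfst _ uu) => Z [/B1D].
  - by apply: (usc_in_comp (f := v) csnd _ uv) => Z [_ /B2D].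
  - apply: continuous_usc => Z _; apply: cvgN; apply: cvgM; first exact: cvg_cst.
    apply: (@continuous_comp _ _ _ (fun Z : spacetime R n * spacetime R n => Z.1 - Z.2) (@sq R n)).
      by apply: cvgB; [exact: cvg_fst|exact: cvg_snd].
    exact: sq_continuous.
  - apply: continuous_usc => Z _; apply: cvgN.
    exact: csqX.
  - apply: continuous_usc => Z _; apply: cvgN.
    exact: csqY.
have KZ0 : K (X0, Y0).
  split; split => /=; [by rewrite subrr sq0 ltW|by have [] := DX0|
    by rewrite subrr sq0 ltW|by have [] := DY0].
have gZ0 : g (X0, Y0) = 0 by rewrite /g /= XY0 subrr.
have uniq Z : K Z -> g Z = 0 -> f (X0, Y0) <= f Z -> Z = (X0, Y0).
  case: Z => X Y [/B1D DX /B2D DY] /eqP; rewrite /g /= subr_eq0 => /eqP XY.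
  have := hmax _ _ DX DY XY; rewrite /f /= !subrr sq0 !subr0.
  have := sq_ge0 (X - X0); have := sq_ge0 (Y - Y0) => y0 x0 h1 h2.
  have sq_eq0 (W : spacetime R n) : sq W <= 0 -> W = 0.
    move=> W0; apply/eqP; rewrite -normr_eq0 -sqrf_eq0 eq_le sqr_ge0 andbT.
    apply: le_trans _ W0; exact: norm_le_sq.
  by congr (_, _); apply/eqP; rewrite -subr_eq0; apply/eqP/sq_eq0; lra.
(* The strict inequalities put the maximizer in the relative interior of the half-balls, so that a
   maximum over [K] is a local one over [interior_times T]. *)
have NN : nbhs (X0, Y0) (N `&` [set Z | sq (Z.1 - X0) < r1 /\ sq (Z.2 - Y0) < r2]).
  apply: filterI => //; apply: filterI.
    by have := csqX (X0, Y0); rewrite /continuous_at /= subrr sq0 => /cvgr_lt; exact.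
  by have := csqY (X0, Y0); rewrite /continuous_at /= subrr sq0 => /cvgr_lt; exact.
have [j [[X Y] [j0 [/= B1X B2Y] [NZ [/= Xr Yr]] Zmax]]] :=
  penalized_maximizer_near p cK uf (@normal_gap_continuous R n) KZ0 gZ0 uniq NN.
(* The factor 2 comes from differentiating j times the squared gap. *)
exists X, Y, (2 * j); split; [by []|exact: B1D|exact: B2D|lra|]; rewrite /=.
have near_ball (r : R) (W W0 : spacetime R n) : sq (W - W0) < r ->
    \forall W' \near within (interior_times T) (nbhs W),
      sq (W' - W0) <= r /\ 0 <= W'.2.2.
  move=> Wr; rewrite near_withinE.
  have : \forall W' \near W, sq (W' - W0) < r.
    by have := @sqB_continuous _ _ W0 W; rewrite /continuous_at => /cvgr_lt; exact.
  by apply: filterS => W' /ltW W'r [_ W'O].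
split.
  apply: (@parab_above_max _ _ _ _ (fun X' => (k / 2 * sq (X' - Y) + 1 * sq (X' - X0)) +
    (p * X'.2.2 + j * (X'.2.2 - Y.2.2) ^+ 2))).
    apply: filterS (near_ball _ _ _ Xr) => X' B1X'.
    have := Zmax (X', Y) (conj B1X' B2Y); rewrite /f /=; lra.
  have -> : k *: (X - Y) + 2 *: (X - X0) + (0, (0, p + 2 * j * (X.2.2 - Y.2.2))) =
      (2 * (k / 2)) *: (X - Y) + (2 * 1) *: (X - X0) + (0, (0, p + 2 * j * (X.2.2 - Y.2.2))).
    by rewrite mulr1 mulrCA divff ?mulr1 ?pnatr_eq0.
  by apply: parab_aboveD; [apply: parab_aboveD; exact: parab_above_sq|exact: parab_above_normal].
apply: (@parab_above_max _ _ _ _ (fun Y' => (k / 2 * sq (Y' - X) + 1 * sq (Y' - Y0)) +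
    (- p * Y'.2.2 + j * (Y'.2.2 - X.2.2) ^+ 2))).
  apply: filterS (near_ball _ _ _ Yr) => Y' B2Y'.
  have := Zmax (X, Y') (conj B1X B2Y'); rewrite /f /= [sq (X - Y)]sqBC [sq (X - Y')]sqBC; lra.
have -> : k *: (Y - X) + 2 *: (Y - Y0) - (0, (0, p + 2 * j * (X.2.2 - Y.2.2))) =
    (2 * (k / 2)) *: (Y - X) + (2 * 1) *: (Y - Y0) + (0, (0, - p + 2 * j * (Y.2.2 - X.2.2))).
  rewrite mulr1 mulrCA divff ?mulr1 ?pnatr_eq0 //; congr (_ + _).
  rewrite -[LHS]/(- (0 : R), (- (0 : 'rV[R]_n), - (p + 2 * j * (X.2.2 - Y.2.2)))) !oppr0.
  by do 2 congr (_, _); ring.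
by apply: parab_aboveD; [apply: parab_aboveD; exact: parab_above_sq|exact: parab_above_normal].
Qed.

(** * Estimate near the initial time *)

Definition all_times (R : realType) n (T : R) : set (spacetime R n) :=
  `[0, T[ `*` @Omegabar R n.
Arguments all_times {R n} T.

Definition quadratic_modulus (R : realType) n (f : space R n -> R) :=
  forall k, 0 < k -> exists2 K, 0 <= K & forall x y, Omegabar x -> Omegabar y ->
    f x - f y <= k + K * ssq (x - y).

Lemma closed_times (R : realType) n (a b : R) :
  closed [set X : spacetime R n | a <= X.1 <= b].
Proof.
have : closed ((fun X : spacetime R n => X.1) @^-1` `[a, b]%classic).
  apply: preimage_closed; last exact: itv_closed.
  by move=> X _; exact: cvg_fst.
by under [X in closed X -> _]eq_set do rewrite /= in_itv /=.
Qed.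

Lemma time_bound (R : realType) (T t mu c : R) :
  0 < c -> 0 < mu -> t < T -> mu / (T - t) <= c -> t <= T - mu / c.
Proof.
move=> c0 mu0 tT; rewrite ler_pdivrMr ?subr_gt0 // => h.
have : mu / c <= T - t by rewrite ler_pdivrMr // mulrC.
lra.
Qed.

Lemma inv_time_usc (R : realType) n (T a : R) :
  usc_in (all_times T) (fun X : spacetime R n => - (a / (T - X.1))).
Proof.
apply: continuous_usc => X [/= + _]; rewrite in_itv /= => /andP [_ XT].
apply: cvgN; apply: cvgM; first exact: cvg_cst.
apply: cvgV; first by rewrite subr_eq0 gt_eqF.
by apply: cvgB; [exact: cvg_cst|exact: cvg_fst].
Qed.

Lemma sq_space_bound (R : realType) n (X : spacetime R n) (M : R) :
  0 <= M -> ssq X.2 <= M -> sbox (1 + M) X.2.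
Proof.
move=> M0 XM; have e : ssq X.2 = vdot X.2.1 X.2.1 + X.2.2 ^+ 2 by rewrite /ssq /sdot expr2.
have v0 := vdot_ge0 X.2.1; have s0 := sqr_ge0 X.2.2.
have aux (a : R) : a ^+ 2 <= M -> `|a| <= 1 + M.
  by rewrite -real_normK ?num_real //; have := normr_ge0 a; move: `|a| => b; nra.
split => [i|]; apply: aux; first by have := le_coord_vdot X.2.1 i; lra.
lra.
Qed.

(** If the bound failed at [X0], [u] minus the barrier [pen] would have a maximum. The initial
    condition excludes it at time 0; at a positive time the spatial gradient is bounded
    independently of [X0], so [K] is bounded below and the slope [L] violates the subsolution
    inequality. Leaving [K] general lets the lemma serve both [u] and the opposite of [v]. *)
Lemma initial_estimate (R : realType) n (T C : R) (K : spacetime R n -> space R n -> R)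
    (u : spacetime R n -> R) (g : space R n -> R) :
  0 < C -> usc_in (all_times T) u ->
  psub (interior_times T) (interior_times T) K u ->
  (forall L, exists B, forall X p, interior_times T X -> sbox L p -> B <= K X p) ->
  quadratic_modulus g ->
  (forall X, all_times T X -> u X <= g X.2 + C) ->
  (forall x, Omegabar x -> u (0, x) <= g x) ->
  forall k, 0 < k -> exists2 L, 0 <= L &
    forall X, all_times T X -> u X <= g X.2 + k + L * X.1.
Proof.
move=> C0 uu uK Klb qg gC g0 k k0.
(* The excess of [K2] over [K1] confines the points where [m] is large to ssq (x - x0) <= C. *)
have [K1 K10 gK1] := qg k k0; pose K2 := K1 + 1.
(* The box contains every gradient 2 K2 (x - x0) with ssq (x - x0) <= C; [L] is taken so that L + B
   > 0. *)
have [B KB] := Klb (2 * K2 * (1 + C)); pose L : R := `|B| + 1.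
(* The extra K2 T absorbs the time part K2 t0^2 of the penalty at [X0], since t0 < T. *)
exists (L + K2 * `|T|).
  by apply: addr_ge0; [rewrite /L|apply: mulr_ge0; rewrite // /K2; lra].
move=> X0 [/= + X0O]; rewrite in_itv /= => /andP [t0 tT].
have T0 : 0 < T by lra.
rewrite (gtr0_norm T0) leNgt; apply/negP => uX0.
(* The barrier mu / (T - t) uses half of the excess at [X0]. *)
pose mu := (u X0 - (g X0.2 + k + (L + K2 * T) * X0.1)) * (T - X0.1) / 2.
have mu0 : 0 < mu by rewrite divr_gt0 // mulr_gt0 // subr_gt0.
pose O : spacetime R n := (0, X0.2).
pose pen (X : spacetime R n) := K2 * sq (X - O) + L * X.1 + mu / (T - X.1).
pose m X := u X - pen X.
have sqO X : sq (X - O) = X.1 ^+ 2 + ssq (X.2 - X0.2).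
  by rewrite /sq /stdot /= subr0 expr2.
have mX0 : g X0.2 + k < m X0.
  have : mu / (T - X0.1) = (u X0 - (g X0.2 + k + (L + K2 * T) * X0.1)) / 2.
    by rewrite /mu -mulrA -mulrA [_ * (2^-1 / _)]mulrCA mulfV ?mulr1 // gt_eqF // subr_gt0.
  rewrite /m /pen sqO subrr => ->; have -> : ssq (0 : space R n) = 0.
    by have := sqO O; rewrite subrr /= subrr expr0n /= add0r => <-; rewrite /sq stdot0.
  have : 0 <= K2 * (X0.1 * (T - X0.1)).
    by apply: mulr_ge0; [rewrite /K2; lra|apply: mulr_ge0 => //; lra].
  lra.
have super X : all_times T X -> g X0.2 + k < m X ->
    ssq (X.2 - X0.2) <= C /\ mu / (T - X.1) <= C.
  move=> AX; have := gC _ AX; case: AX => /= + XO; rewrite in_itv /= => /andP [Xt XT].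
  have := gK1 _ _ XO X0O; have := ssq_ge0 (X.2 - X0.2).
  have : 0 < mu / (T - X.1) by rewrite divr_gt0 // subr_gt0.
  rewrite /m /pen sqO.
  have : 0 <= K2 * X.1 ^+ 2 by rewrite mulr_ge0 ?sqr_ge0 // /K2; lra.
  have : 0 <= L * X.1 by rewrite mulr_ge0 // /L; have := normr_ge0 B; lra.
  rewrite /K2; split; lra.
pose A := [set X : spacetime R n | sq (X - O) <= T ^+ 2 + C /\ 0 <= X.2.2] `&`
          [set X | 0 <= X.1 <= T - mu / C].
have cA : compact A by apply: compact_closedI; [exact: compact_half_ball|exact: closed_times].
have AD : A `<=` all_times T.
  move=> X [[_ Xd] /andP [Xt XT]]; split => //=; rewrite in_itv /= Xt /=.
  have : 0 < mu / C by rewrite divr_gt0.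
  lra.
have superA X : all_times T X -> g X0.2 + k < m X -> A X.
  move=> AX mX; have [h1 h2] := super _ AX mX.
  case: AX => /= + XO; rewrite in_itv /= => /andP [Xt XT].
  split; last by rewrite /= Xt /=; exact: time_bound.
  by split => //; rewrite sqO; nra.
have um : usc_in (all_times T) m.
  apply: (@usc_in_sub _ _ (all_times T)) => //.
  have -> : m = (fun X => u X + - (K2 * sq (X - O) + L * X.1) + - (mu / (T - X.1))).
    by apply/funext => X; rewrite /m /pen; lra.
  apply: usc_inD; last exact: inv_time_usc.
  apply: usc_inD => //; apply: continuous_usc => X _.
  apply: cvgN; apply: cvgD; apply: cvgM; try exact: cvg_cst; last exact: cvg_fst.
  exact: sqB_continuous.
have AX0 : all_times T X0 by split => //=; rewrite in_itv /= t0.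
have [X AX Xmax] := usc_max cA (superA _ AX0 mX0) (usc_in_sub AD um).
have mX : g X0.2 + k < m X by apply: (lt_le_trans mX0); apply: (Xmax); exact: superA.
have Xmax' Y : all_times T Y -> m Y <= m X.
  move=> AY; have [h|h] := leP (m Y) (g X0.2 + k); first exact: le_trans h (ltW mX).
  by apply/Xmax/superA.
have [_ XO] := AD _ AX; have /= := (AD _ AX).1; rewrite in_itv /= => /andP [Xt XT].
have [ssqX _] := super _ (AD _ AX) mX.
(* At time 0, u <= g and the quadratic modulus bring [m X] down to at most g x0 + k. *)
have Xt0 : 0 < X.1.
  rewrite lt_neqAle Xt andbT; apply/eqP => X10.
  have := gK1 _ _ XO X0O; have := g0 _ XO; have -> : (0, X.2) = X by rewrite X10; case: (X).
  move: mX; rewrite /m /pen sqO -X10 expr0n /= mulr0 add0r addr0.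
  have : 0 <= mu / (T - 0) by rewrite divr_ge0 ?ltW //; lra.
  have := ssq_ge0 (X.2 - X0.2); rewrite /K2; lra.
have DX : interior_times T X by split => //=; rewrite in_itv /= Xt0.
have : parab_above (interior_times T) u X
    ((2 * K2) *: (X - O) + (L, 0) + (mu / (T - X.1) ^+ 2, 0)).
  apply: (@parab_above_max _ _ _ _ pen).
    rewrite near_withinE; apply: nearW => Y [/= + YO]; rewrite in_itv /= => /andP [Yt YT].
    by apply: Xmax'; split => //=; rewrite in_itv /= ltW.
  apply: parab_aboveD; last by apply: parab_above_inv => //; exact: ltW.
  by apply: parab_aboveD; [exact: parab_above_sq|exact: parab_above_time].
move=> /(uK _ _ DX) /=; rewrite !addr0.
have : sbox (2 * K2 * (1 + C)) ((2 * K2) *: (X.2 - X0.2)).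
  have [h1 h2] := sq_space_bound (X := X - O) (ltW C0) ssqX.
  have K20 : 0 <= 2 * K2 by rewrite /K2; lra.
  split => [i|]; rewrite ?mxE normrM (ger0_norm K20) ler_wpM2l //.
  by have := h1 i; rewrite /= !mxE.
move=> /(KB _ _ DX); set k1 := K X _.
have : 0 <= mu / (T - X.1) ^+ 2 by rewrite divr_ge0 ?sqr_ge0 // ltW.
have : 0 <= 2 * K2 * X.1 by rewrite mulr_ge0 // /K2; lra.
have := ler_norm (- B); rewrite normrN /L subr0; rewrite /GRing.scale /=; lra.
Qed.

(** * Doubling time and tangential coordinates *)

Lemma sqD_le (R : realType) n (X Y : spacetime R n) : sq (X + Y) <= 2 * sq X + 2 * sq Y.
Proof.
have := sq_ge0 (X - Y); rewrite !sqD sqN [stdot X (- Y)]stdotC stdotNl [stdot Y X]stdotC.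
lra.
Qed.

(** [v] is the opposite of the supersolution, so the first two terms form the gap. The terms in
    [eta] keep both times away from [T] and later supply the gain eta / (T - t)^2 at each point. *)
Definition doubled (R : realType) n (T eta k : R) (u v : spacetime R n -> R)
    (Z : spacetime R n * spacetime R n) : R :=
  u Z.1 + v Z.2 - eta / (T - Z.1.1) - eta / (T - Z.2.1) - k / 2 * sq (Z.1 - Z.2).

(** The normal coordinate is shared because [H_tangential] compares [H] only at points of equal
    depth. *)
Definition same_depth (R : realType) n (T : R) : set (spacetime R n * spacetime R n) :=
  [set Z | [/\ all_times T Z.1, all_times T Z.2 & Z.1.2.2 = Z.2.2.2]].
Arguments same_depth {R n} T.

(** The domain is unbounded, so the supremum need not be attained. As [Zs] is maximal up to [a],
    subtracting [a * sq (Z.1 - Zs.1)] leaves competitors only within distance 1 of [Zs.1]. The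
    condition on [k] then bounds the second point, and the terms in [eta] bound the times, whence
    compactness. *)
Lemma same_depth_maximum (R : realType) n (T eta k a C K0 : R)
    (u v : spacetime R n -> R) Zs :
  0 < C -> 0 < eta -> 0 < a -> K0 + 1 <= k / 2 ->
  usc_in (all_times T) u -> usc_in (all_times T) v ->
  (forall Z, same_depth T Z -> u Z.1 + v Z.2 <= C + K0 * sq (Z.1 - Z.2)) ->
  same_depth T Zs -> 0 <= doubled T eta k u v Zs ->
  (forall Z, same_depth T Z -> doubled T eta k u v Z <= doubled T eta k u v Zs + a) ->
  exists Z0, [/\ same_depth T Z0, sq (Z0.1 - Zs.1) <= 1,
    doubled T eta k u v Zs <= doubled T eta k u v Z0 &
    forall Z, same_depth T Z -> doubled T eta k u v Z - a * sq (Z.1 - Zs.1) <=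
      doubled T eta k u v Z0 - a * sq (Z0.1 - Zs.1)].
Proof.
move=> C0 eta0 a0 kK0 uu uv uvC BZs Zs0 Zsa.
pose f Z := doubled T eta k u v Z - a * sq (Z.1 - Zs.1).
have sq0 : sq (0 : spacetime R n) = 0 by rewrite /sq stdot0.
have fZs : f Zs = doubled T eta k u v Zs by rewrite /f subrr sq0 mulr0 subr0.
pose A (r : R) := [set X : spacetime R n | sq (X - Zs.1) <= r /\ 0 <= X.2.2] `&`
          [set X | 0 <= X.1 <= T - eta / C].
have cA r : compact (A r) by apply: compact_closedI; [exact: compact_half_ball|exact: closed_times].
have AD r : A r `<=` all_times T.
  move=> X [[_ Xd] /andP [Xt XT]]; split => //=; rewrite in_itv /= Xt /=.
  have : 0 < eta / C by rewrite divr_gt0.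
  lra.
(* The second radius comes from sq (Y - Xs) <= 2 sq (Y - X) + 2 sq (X - Xs) <= 2 C + 2. *)
pose K := (A 1 `*` A (2 * C + 2)) `&` [set Z | Z.1.2.2 - Z.2.2.2 = 0].
have cK : compact K.
  apply: compact_closedI; first by apply: compact_setX.
  have : closed ((fun Z : spacetime R n * spacetime R n => Z.1.2.2 - Z.2.2.2) @^-1` [set 0]).
    by apply: preimage_closed; [move=> Z _; exact: normal_gap_continuous|exact: closed_eq].
  by [].
have superK Z : same_depth T Z -> f Zs <= f Z -> K Z.
  move=> BZ; rewrite fZs => fZ; have := uvC _ BZ; have := Zsa _ BZ.
  have := sq_ge0 (Z.1 - Z.2); have := sq_ge0 (Z.1 - Zs.1).
  case: BZ => -[/= + X0] [/= + Y0] XY; rewrite !in_itv /= => /andP [Xt XT] /andP [Yt YT].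
  have : 0 < eta / (T - Z.1.1) by rewrite divr_gt0 // subr_gt0.
  have : 0 < eta / (T - Z.2.1) by rewrite divr_gt0 // subr_gt0.
  have := time_bound C0 eta0 XT; have := time_bound C0 eta0 YT.
  move: fZ; rewrite /f {1 2 3}/doubled.
  move: (eta / (T - Z.1.1)) (eta / (T - Z.2.1)) => b c fZ hY hX c0 b0 s0 r0 Z_a Z_C.
  have r1 : 0 <= (k / 2 - K0 - 1) * sq (Z.1 - Z.2) by rewrite mulr_ge0 //; lra.
  have as0 : 0 <= a * sq (Z.1 - Zs.1) by rewrite mulr_ge0 // ltW.
  have sC : sq (Z.1 - Z.2) <= C by rewrite /doubled in fZ Zs0; lra.
  have s1 : sq (Z.1 - Zs.1) <= 1.
    by rewrite -(ler_pM2l a0); rewrite /doubled in Z_a; lra.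
  have bC : b <= C by rewrite /doubled in fZ Zs0; lra.
  have cC : c <= C by rewrite /doubled in fZ Zs0; lra.
  split; last by rewrite /= XY subrr.
  split; split => /=; [by []|by rewrite Xt hX| |by rewrite Yt hY].
  split => //; have -> : Z.2 - Zs.1 = (Z.2 - Z.1) + (Z.1 - Zs.1) by rewrite addrA subrK.
  by have := sqD_le (Z.2 - Z.1) (Z.1 - Zs.1); rewrite [sq (Z.2 - _)]sqBC; lra.
have uf : usc_in K f.
  have cfst : continuous (fst : spacetime R n * spacetime R n -> _) by move=> Z; exact: cvg_fst.
  have csnd : continuous (snd : spacetime R n * spacetime R n -> _) by move=> Z; exact: cvg_snd.
  have K1 Z : K Z -> all_times T Z.1 by move=> [[/AD]].
  have K2 Z : K Z -> all_times T Z.2 by move=> [[_ /AD]].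
  apply: usc_inD; [apply: usc_inD; [apply: usc_inD; [apply: usc_inD; [apply: usc_inD|]|]|]|].
  - exact: (usc_in_comp (f := u) cfst K1 uu).
  - exact: (usc_in_comp (f := v) csnd K2 uv).
  - exact: (usc_in_comp cfst K1 (inv_time_usc (a := eta))).
  - exact: (usc_in_comp csnd K2 (inv_time_usc (a := eta))).
  - apply: continuous_usc => Z _; apply: cvgN; apply: cvgM; first exact: cvg_cst.
    apply: (@continuous_comp _ _ _ (fun Z : spacetime R n * spacetime R n => Z.1 - Z.2) (@sq R n)).
      by apply: cvgB; [exact: cvg_fst|exact: cvg_snd].
    exact: sq_continuous.
  - apply: continuous_usc => Z _; apply: cvgN; apply: cvgM; first exact: cvg_cst.
    apply: (@continuous_comp _ _ _ fst (fun X : spacetime R n => sq (X - Zs.1))).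
      exact: cvg_fst.
    exact: sqB_continuous.
have [Z0 KZ0 Z0max] := usc_max cK (superK _ BZs (lexx _)) uf.
have fZ0 : f Zs <= f Z0 by apply: Z0max; exact: superK.
have BZ0 : same_depth T Z0.
  by case: KZ0 => -[/AD h1 /AD h2] /= /eqP; rewrite subr_eq0 => /eqP.
have Z0s := sq_ge0 (Z0.1 - Zs.1).
exists Z0; split => //.
- by case: KZ0 => -[[[]]].
- move: fZ0; rewrite fZs /f; have : 0 <= a * sq (Z0.1 - Zs.1) by rewrite mulr_ge0 // ltW.
  lra.
move=> Z BZ; have [h|/ltW h] := leP (f Z) (f Zs); first exact: le_trans h fZ0.
by apply/Z0max/superK.
Qed.

(** * Contradiction at the maximum *)

Lemma parab_above_unperturbed (R : realType) n (D : set (spacetime R n)) (u : spacetime R n -> R)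
    (T eta a : R) X Xs G :
  X.1 < T -> 0 <= eta ->
  parab_above D (fun X => u X - eta / (T - X.1) - a * sq (X - Xs)) X G ->
  parab_above D u X (G + (2 * a) *: (X - Xs) + (eta / (T - X.1) ^+ 2, 0)).
Proof.
move=> XT eta0 uG.
have := parab_aboveD (parab_aboveD uG (parab_above_sq D X Xs a)) (parab_above_inv D XT eta0).
by under [X in parab_above _ X]funext do rewrite subrK subrK.
Qed.

(** Gradients at the doubled maximum differ from those at [(X0, Y0)] by components of such
    combinations. *)
Definition shift (R : realType) n (X0 Y0 : spacetime R n) (a b : R)
    (Z : spacetime R n * spacetime R n) : spacetime R n :=
  a *: (Z.1 - X0) + b *: (Z.2 - Y0).

Lemma shift_cvg (R : realType) n (X0 Y0 : spacetime R n) (a b : R) :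
  shift X0 Y0 a b Z @[Z --> (X0, Y0)] --> (0 : spacetime R n).
Proof.
have -> : 0 = a *: (X0 - X0) + b *: (Y0 - Y0) by rewrite !subrr !scaler0 addr0.
apply: cvgD; apply: cvgZr; apply: cvgB; try exact: cvg_cst.
  exact: cvg_fst.
exact: cvg_snd.
Qed.

(** If f Q <= d, the intermediate value theorem gives f p = d and monotonicity does the rest.
    Otherwise p = Q, and beyond [Q] the coercive [h] takes over. *)
Lemma boundary_slope (R : realType) (f h : R -> R) (Q d : R) :
  0 <= Q -> 0 < d -> continuous f -> {homo f : a b /~ a <= b} ->
  d < f (- Q) -> (forall q, Q <= q -> 2 * d < h q) ->
  exists p, [/\ p <= Q, forall q, q <= p -> d <= f q &
    forall q, p <= q -> f q <= d \/ 2 * d < h q].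
Proof.
move=> Q0 d0 cf mf fQ hQ; have [fQd|fQd] := leP (f Q) d; last first.
  exists Q; split => // q qQ; last by right; exact: hQ.
  exact: le_trans (ltW fQd) (mf _ _ qQ).
have [|||p pI fp] := @IVT R f (- Q) Q d.
- lra.
- exact: continuous_subspaceT.
- by rewrite ge_min le_max fQd (ltW fQ) orbT.
move: pI; rewrite in_itv /= => /andP [_ pQ]; exists p; split => // q qp.
  by rewrite -fp mf.
by left; rewrite -fp mf.
Qed.

(** The scalar core of the argument. [bX] and [bY] say that the doubled points lie on the boundary;
    capital letters with [g1], [g2] are values at these points, while [h1], [f1], [h2], [f2] are
    values at the original maximum with the same slope [q]. *)
Lemma slopes_absurd (R : realType) (bX bY : Prop)
    (d L Q p q e z g1 g2 HX FX HY FY h1 f1 h2 f2 : R) :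
  0 < d -> `|e| <= 1 -> `|z| <= 1 -> p <= Q - 1 -> - L < g1 ->
  (Q - 2 <= `|q + e + z| -> L < HX) ->
  (bX -> q + e + z <= - (Q - 2) -> L < FX) ->
  g1 + HX <= 0 \/ bX /\ g1 + FX <= 0 ->
  0 <= - g2 + HY \/ bY /\ 0 <= - g2 + FY ->
  (bX -> q <= p) -> (bY -> p <= q) ->
  (`|q| <= Q -> h1 < g1 + HX + d / 2) -> (bX -> `|q| <= Q -> f1 < g1 + FX + d / 2) ->
  (`|q| <= Q -> - g2 + HY < h2 + d / 2) -> (bY -> `|q| <= Q -> - g2 + FY < f2 + d / 2) ->
  (bX -> q <= p -> d / 2 <= f1) -> (bY -> p <= q -> f1 <= d / 2 \/ d < h1) ->
  (`|q| <= Q -> h1 <= d -> h2 <= - d) ->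
  (bY -> `|q| <= Q -> h1 <= d -> f1 <= d -> f2 <= - d) -> False.
Proof.
move=> d0; rewrite !ler_norml => /andP [e1 e1'] /andP [z1 z1'] pQ g1L coH coF subX supY.
move=> qp pq cHX cFX cHY cFY pl pr cmpH cmpF.
(* In the [H] alternative coercivity bounds [q] on both sides. In the [F] alternative it bounds [q]
   only from below, and q <= p <= Q - 1 gives the other side. The margin 2 in [Q - 2] covers [e] and
   [z]. *)
have qQ : - Q <= q <= Q.
  case: subX => [h|[b h]].
    have : `|q + e + z| < Q - 2 by rewrite ltNge; apply/negP => /coH; lra.
    by rewrite ltr_norml => /andP [? ?]; apply/andP; split; lra.
  have : - (Q - 2) < q + e + z by rewrite ltNge; apply/negP => /(coF b); lra.
  by have := qp b; move=> ? ?; apply/andP; split; lra.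
have h1d : h1 <= d.
  case: subX => [h|[b h]]; first by have := cHX qQ; lra.
  by have := cFX b qQ; have := pl b (qp b); lra.
have := cmpH qQ h1d; case: supY => [h|[b h]]; first by have := cHY qQ; lra.
have f1d : f1 <= d by case: (pr b (pq b)); lra.
by have := cmpF b qQ h1d f1d; have := cFY b qQ; lra.
Qed.

Lemma sum_close (R : realType) (b s s' K K' d : R) :
  `|s - s'| < d / 4 -> `|K' - K| < d / 4 ->
  b + s + K < b + s' + K' + d / 2 /\ b + s' + K' < b + s + K + d / 2.
Proof. by rewrite !ltr_norml => /andP [? ?] /andP [? ?]; split; lra. Qed.

Lemma in_box_shift (R : realType) (q e Q : R) : `|q| <= Q -> `|e| <= 1 ->
  - (Q + 1) <= q + e <= Q + 1.
Proof. by rewrite !ler_norml => /andP [? ?] /andP [? ?]; apply/andP; split; lra. Qed.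

Lemma slope_le (R : realType) (p m y : R) : 0 <= m -> 0 <= y ->
  p + m * (0 - y) - 2 * (y - 0) <= p.
Proof. by move=> m0 y0; have := mulr_ge0 m0 y0; lra. Qed.

Lemma slope_ge (R : realType) (p m x : R) : 0 <= m -> 0 <= x ->
  p <= p + m * (x - 0) - 2 * (0 - 0).
Proof. by move=> m0 x0; have := mulr_ge0 m0 x0; lra. Qed.

Lemma time_slope_bound (R : realType) (L b s t d : R) :
  - L + 1 <= b -> d <= 1 -> 0 <= s -> `|s - t| < d / 4 -> - L < b + t.
Proof. by move=> ? ? ?; rewrite ltr_norml => /andP [? ?]; lra. Qed.

(** [h1], [f1] at [X0] and [h2], [f2] at [Y0] are the [H] and [F] expressions as functions of the
    normal slope; [e] is the gradient of the term in [a]. Once [p] is fixed from [f1] and [h1], the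
    doubled points are taken so close to [(X0, Y0)] that each expression moves by less than d / 2.
    The last two hypotheses carry the tangential comparison from [X0] to [Y0]. *)
Lemma doubled_maximum_absurd (R : realType) n (T k a eta d L Q : R)
    (H F : spacetime R n -> space R n -> R) (u v : spacetime R n -> R) (X0 Y0 Xs : spacetime R n) :
  let D : set (spacetime R n) := interior_times T in
  let Din : set (spacetime R n) := `]0, T[ `*` @Omega R n in
  let Dbd : set (spacetime R n) := `]0, T[ `*` @bdOmega R n in
  let A : set (spacetime R n) := `[0, T] `*` @Omegabar R n in
  let Abd : set (spacetime R n) := `[0, T] `*` @bdOmega R n in
  let pt : spacetime R n := k *: (X0 - Y0) in
  let e : spacetime R n := (2 * a) *: (X0 - Xs) in
  let h1 (q : R) : R := pt.1 + e.1 + eta / (T - X0.1) ^+ 2 + H X0 (pt.2.1 + e.2.1, q + e.2.2) in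
  let f1 (q : R) : R := pt.1 + e.1 + eta / (T - X0.1) ^+ 2 + F X0 (pt.2.1 + e.2.1, q + e.2.2) in
  let h2 (q : R) : R := pt.1 - eta / (T - Y0.1) ^+ 2 + H Y0 (pt.2.1, q) in
  let f2 (q : R) : R := pt.1 - eta / (T - Y0.1) ^+ 2 + F Y0 (pt.2.1, q) in
  0 <= k -> 0 <= a -> 0 <= eta -> 0 < d -> d <= 1 -> 2 <= Q ->
  usc_in (all_times T) u -> usc_in (all_times T) v ->
  psub D Din H u -> psub D Dbd (fun X p => Num.min (F X p) (H X p)) u ->
  psub D Din (fun X p => - H X (- p)) v ->
  psub D Dbd (fun X p => - Num.max (F X (- p)) (H X (- p))) v ->
  continuous_jointly A H -> continuous_jointly Abd F ->
  (forall (X : spacetime R n) (p' : 'rV[R]_n), Abd X ->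
    {homo (fun pd => F X (p', pd)) : a b /~ a <= b}) ->
  D X0 -> D Y0 -> X0.2.2 = Y0.2.2 -> 0 <= Xs.2.2 ->
  (forall Z, same_depth T Z -> doubled T eta k u v Z - a * sq (Z.1 - Xs) <=
      doubled T eta k u v (X0, Y0) - a * sq (X0 - Xs)) ->
  `|e.2.2| <= 1 -> - L + 1 <= pt.1 + e.1 -> vbox (L - 1) (pt.2.1 + e.2.1) ->
  (forall X p' pd, A X -> vbox L p' -> Q - 2 <= `|pd| -> L < H X (p', pd)) ->
  (forall X p' pd, Abd X -> vbox L p' -> pd <= - (Q - 2) -> L < F X (p', pd)) ->
  (forall q, `|q| <= Q -> h1 q <= d -> h2 q <= - d) ->
  (X0.2.2 = 0 -> forall q, `|q| <= Q -> h1 q <= d -> f1 q <= d -> f2 q <= - d) ->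
  False.
Proof.
move=> D Din Dbd A Abd pt e h1 f1 h2 f2 k0 a0 eta0 d0 d1 Q2 uu uv uin ubd vin vbd cH cF mF.
move=> DX0 DY0 XY0 Xs0 hmax e1 Le Lbox coH coF cmpH cmpF.
have DA X : D X -> A X.
  move=> [/= + XO]; rewrite in_itv /= => /andP [t0 tT].
  by split => //=; rewrite in_itv /= !ltW.
have DAbd X : D X -> X.2.2 = 0 -> Abd X by move=> /DA [].
have AX0 := DA _ DX0; have AY0 := DA _ DY0.
have [X0t X0T] : 0 < X0.1 /\ X0.1 < T by case: DX0 => /=; rewrite in_itv /= => /andP [].
have [Y0t Y0T] : 0 < Y0.1 /\ Y0.1 < T by case: DY0 => /=; rewrite in_itv /= => /andP [].
have eta2 t : 0 <= eta / (T - t) ^+ 2 by rewrite divr_ge0 ?sqr_ge0.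
have [p [pQ pbd]] : exists p, p <= Q - 1 /\ (X0.2.2 = 0 ->
    (forall q, q <= p -> d / 2 <= f1 q) /\
    (forall q, p <= q -> f1 q <= d / 2 \/ d < h1 q)).
  (* Away from the boundary nothing is asked of [p] beyond p <= Q - 1, and 0 will do. *)
  have [Xb|Xb] := eqVneq X0.2.2 0; last by exists 0; split; [lra|move=> /eqP; rewrite (negPf Xb)].
  have AbX0 := DAbd _ DX0 Xb.
  have vL : vbox L (pt.2.1 + e.2.1) by move=> i; apply: le_trans (Lbox i) _; lra.
  have e2 : - 1 <= e.2.2 <= 1 by rewrite -ler_norml.
  have d2 : 2 * (d / 2) = d by field.
  have [||||||p [pQ pl pr]] := @boundary_slope R f1 h1 (Q - 1) (d / 2); last first.
  - exists p; split => // _; split => // q /pr [|h]; [by left|right].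
    by move: h; rewrite d2.
  - move=> q Qq; have := coH X0 _ (q + e.2.2) AX0 vL; rewrite ger0_norm; last by lra.
    have := eta2 X0.1; rewrite /h1 d2 => h /(_ _); lra.
  - have := coF X0 _ (- (Q - 1) + e.2.2) AbX0 vL; have := eta2 X0.1; rewrite /f1 => h /(_ _); lra.
  - move=> q q' qq; rewrite /f1 lerD2l; apply: mF => //; rewrite lerD2r //.
  - move=> q; rewrite /f1; apply: cvgD; first exact: cvg_cst.
    apply: (@continuous_comp _ _ _ (fun q : R => (pt.2.1 + e.2.1, q + e.2.2) : space R n) (F X0)).
      apply: (@cvg_pair _ _ _ _ (nbhs (pt.2.1 + e.2.1)) (nbhs (q + e.2.2))).
        exact: cvg_cst.
      by apply: cvgD; [exact: cvg_id|exact: cvg_cst].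
    exact: continuous_jointly_gradient cF AbX0 _.
  - by lra.
  - by lra.
pose ut X := u X - eta / (T - X.1) - a * sq (X - Xs).
pose vt X := v X - eta / (T - X.1).
have DD0 : D `<=` all_times T.
  by move=> X [/= + XO]; rewrite in_itv /= => /andP [t0 tT]; split => //=; rewrite in_itv /= ltW.
have uut : usc_in D ut.
  apply: (usc_in_sub DD0); apply: usc_inD; first by apply: usc_inD => //; exact: inv_time_usc.
  apply: continuous_usc => X _; apply: cvgN; apply: cvgM; first exact: cvg_cst.
  exact: sqB_continuous.
have uvt : usc_in D vt by apply: (usc_in_sub DD0); apply: usc_inD => //; exact: inv_time_usc.
have hmaxt X Y : D X -> D Y -> X.2.2 = Y.2.2 ->
    ut X + vt Y - k / 2 * sq (X - Y) <= ut X0 + vt Y0 - k / 2 * sq (X0 - Y0).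
  move=> DX DY XY; have := hmax (X, Y); rewrite /doubled /ut /vt /= => /(_ _).
  have BXY : same_depth T (X, Y) by split => //; exact: DD0.
  by move=> /(_ BXY); lra.
pose Z0 : spacetime R n * spacetime R n := (X0, Y0).
have FZ : Filter (nbhs Z0) by exact: nbhs_filter.
(* In the normal component the terms in [k] go into [q] below, so only the coefficients 2 and 2 a
   remain. *)
pose z1 Z : space R n :=
  ((shift X0 Y0 (k + 2 + 2 * a) (- k) Z).2.1, (shift X0 Y0 (2 + 2 * a) 2 Z).2.2).
pose z2 Z : space R n := ((shift X0 Y0 k (- (k + 2)) Z).2.1, 0).
have cz1 : z1 Z @[Z --> Z0] --> (0 : space R n).
  apply: (@cvg_pair _ _ _ _ (nbhs (0 : 'rV[R]_n)) (nbhs (0 : R))).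
    exact: (cvg_comp _ _ (cvg_comp _ _ (shift_cvg _ _ _ _) cvg_snd) cvg_fst).
  exact: (cvg_comp _ _ (cvg_comp _ _ (shift_cvg _ _ _ _) cvg_snd) cvg_snd).
have cz2 : z2 Z @[Z --> Z0] --> (0 : space R n).
  apply: (@cvg_pair _ _ _ _ (nbhs (0 : 'rV[R]_n)) (nbhs (0 : R))).
    exact: (cvg_comp _ _ (cvg_comp _ _ (shift_cvg _ _ _ _) cvg_snd) cvg_fst).
  exact: cvg_cst.
pose P := [set P0 : space R n |
  (P0.1 = pt.2.1 + e.2.1 \/ P0.1 = pt.2.1) /\ - (Q + 1) <= P0.2 <= Q + 1].
have cP : compact P.
  have -> : P = ([set pt.2.1 + e.2.1] `|` [set pt.2.1]) `*` `[- (Q + 1), Q + 1]%classic.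
    by apply/seteqP; split => -[p1 p2] /=; rewrite /P /= in_itv.
  by apply: compact_setX; [apply: compactU; exact: compact_set1|exact: segment_compact].
have d40 : 0 < d / 4 by rewrite divr_gt0.
(* The flag [c] is true for [H]; for [F] it says that [X0] lies on the boundary, where alone [F] is
   known to be continuous. One neighbourhood then serves both cases. *)
have cvg_at (c : bool) (z : spacetime R n * spacetime R n -> space R n)
    (W : spacetime R n * spacetime R n -> spacetime R n) W0 B K :
    z Z @[Z --> Z0] --> (0 : space R n) -> W Z @[Z --> Z0] --> W0 ->
    continuous_jointly B K -> (c -> B W0) ->
    \forall Z \near Z0, c -> B (W Z) -> forall q, P q -> `|K (W Z) (q + z Z) - K W0 q| < d / 4.
  move=> cz cW cK; case: c => [BW0|_]; last by apply: (@nearW _ (nbhs Z0) _ FZ) => Z.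
  have := near_uniform_on_compact cK (BW0 isT) cP d40 => nW.
  have cWz : (W Z, z Z) @[Z --> Z0] --> (W0, (0 : space R n)).
    by apply: (@cvg_pair _ _ _ _ (nbhs W0) (nbhs (0 : space R n))).
  have h : \forall Z \near Z0, B (W Z) -> forall q, P q ->
    `|K (W Z) (q + z Z) - K W0 q| < d / 4 := cWz _ nW.
  by move: h; apply: (@filterS _ (nbhs Z0) FZ) => Z h _.
have cfst : (Z.1 @[Z --> Z0] --> X0) by exact: cvg_fst.
have csnd : (Z.2 @[Z --> Z0] --> Y0) by exact: cvg_snd.
have nH1 := cvg_at true _ _ _ _ _ cz1 cfst cH (fun _ => AX0).
have nH2 := cvg_at true _ _ _ _ _ cz2 csnd cH (fun _ => AY0).
have bX0 : X0.2.2 == 0 -> Abd X0 by move=> /eqP; exact: DAbd.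
have bY0 : X0.2.2 == 0 -> Abd Y0 by rewrite XY0 => /eqP; exact: DAbd.
have nF1 := cvg_at _ _ _ _ _ _ cz1 cfst cF bX0.
have nF2 := cvg_at _ _ _ _ _ _ cz2 csnd cF bY0.
pose t1 (Z : spacetime R n * spacetime R n) :=
  (shift X0 Y0 (k + 2 + 2 * a) (- k) Z).1 + eta / (T - Z.1.1) ^+ 2.
pose t2 (Z : spacetime R n * spacetime R n) :=
  (shift X0 Y0 k (- (k + 2)) Z).1 - eta / (T - Z.2.1) ^+ 2.
have cinv (W0 : spacetime R n) (W : spacetime R n * spacetime R n -> spacetime R n) :
    W0.1 < T -> W Z @[Z --> Z0] --> W0 ->
    eta / (T - (W Z).1) ^+ 2 @[Z --> Z0] --> eta / (T - W0.1) ^+ 2.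
  move=> W0T cW; apply: cvgM; first exact: cvg_cst.
  have cT : T - (W Z).1 @[Z --> Z0] --> T - W0.1.
    by apply: cvgB; [exact: cvg_cst|exact: (cvg_comp _ _ cW cvg_fst)].
  by apply: cvgV; [rewrite expf_neq0 // subr_eq0 gt_eqF|apply: cvgM].
have nt1 : \forall Z \near Z0, `|eta / (T - X0.1) ^+ 2 - t1 Z| < d / 4.
  have ct1 : t1 Z @[Z --> Z0] --> 0 + eta / (T - X0.1) ^+ 2.
    by apply: cvgD; [exact: (cvg_comp _ _ (shift_cvg _ _ _ _) cvg_fst)|exact: cinv].
  by move: ct1; rewrite add0r => /cvgrPdist_lt /(_ _ d40).
have nt2 : \forall Z \near Z0, `|- (eta / (T - Y0.1) ^+ 2) - t2 Z| < d / 4.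
  have ct2 : t2 Z @[Z --> Z0] --> 0 - eta / (T - Y0.1) ^+ 2.
    by apply: cvgB; [exact: (cvg_comp _ _ (shift_cvg _ _ _ _) cvg_fst)|exact: cinv].
  by move: ct2; rewrite add0r => /cvgrPdist_lt /(_ _ d40).
have nz1 : \forall Z \near Z0, `|z1 Z| < 1.
  move/cvgrPdist_lt : cz1 => /(_ _ ltr01); apply: (@filterS _ (nbhs Z0) FZ) => Z.
  by rewrite sub0r normrN.
(* Read contrapositively: a doubled point on the boundary forces [X0] onto the boundary. *)
have nint : \forall Z \near Z0, 0 < X0.2.2 -> 0 < Z.1.2.2 /\ 0 < Z.2.2.2.
  have [Xb|Xb] := ltP 0 X0.2.2; last by apply: (@nearW _ (nbhs Z0) _ FZ) => Z.
  have c1 : Z.1.2.2 @[Z --> Z0] --> X0.2.2.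
    exact: (cvg_comp _ _ (cvg_comp _ _ cfst cvg_snd) cvg_snd).
  have c2 : Z.2.2.2 @[Z --> Z0] --> Y0.2.2.
    exact: (cvg_comp _ _ (cvg_comp _ _ csnd cvg_snd) cvg_snd).
  have g1 : \forall Z \near Z0, 0 < Z.1.2.2 by apply: (cvgr_gt _ c1).
  have g2 : \forall Z \near Z0, 0 < Z.2.2.2 by apply: (cvgr_gt _ c2); rewrite -XY0.
  by apply: (@filterS2 _ (nbhs Z0) FZ) g1 g2 => Z.
have FI := @filterI _ (nbhs Z0) FZ.
have Nall :=
  FI _ _ (FI _ _ (FI _ _ (FI _ _ (FI _ _ (FI _ _ (FI _ _ nH1 nH2) nF1) nF2) nt1) nt2) nz1) nint.
have [X [Y [j [NXY DX DY j0 /= [uG vG]]]]] := normal_doubling p k0 uut uvt DX0 DY0 XY0 hmaxt Nall.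
move: NXY => [[[[[[[]]]]]]] /= N1 N2 N3 N4 N5 N6 N7 N8.
have [Xt XT] : 0 < X.1 /\ X.1 < T by case: DX => /=; rewrite in_itv /= => /andP [].
have [Yt YT] : 0 < Y.1 /\ Y.1 < T by case: DY => /=; rewrite in_itv /= => /andP [].
have {}uG := parab_above_unperturbed XT eta0 uG.
have {}vG : parab_above D v Y (k *: (Y - X) + 2 *: (Y - Y0) - (0, (0, p + j * (X.2.2 - Y.2.2))) +
    (eta / (T - Y.1) ^+ 2, 0)).
  have := parab_aboveD vG (parab_above_inv D YT eta0).
  by under [X in parab_above _ X]funext do rewrite subrK.
set G1 := _ + (eta / _, 0) in uG; set G2 := _ + (eta / _, 0) in vG.
(* This is exactly the normal slope at [Y], hence the 0 in [z2]. As [j] is not bounded in advance,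
   [q] is controlled only by coercivity and by its position relative to [p]. *)
pose q := p + (k + j) * (X.2.2 - Y.2.2) - 2 * (Y.2.2 - Y0.2.2).
have G1t : G1.1 = pt.1 + e.1 + t1 (X, Y).
  by rewrite /G1 /pt /e /t1 /shift /= /GRing.scale /=; ring.
have G2t : - G2.1 = pt.1 + t2 (X, Y).
  by rewrite /G2 /pt /t2 /shift /= /GRing.scale /=; ring.
have G1x : G1.2 = ((pt.2.1 + e.2.1, q + e.2.2) : space R n) + z1 (X, Y).
  congr (_, _); first by apply/rowP => i; rewrite !mxE; ring.
  by rewrite /q /e /= /GRing.scale /= -XY0; ring.
have G2x : - G2.2 = ((pt.2.1, q) : space R n) + z2 (X, Y).
  congr (_, _); first by apply/rowP => i; rewrite !mxE; ring.
  by rewrite /q /= /GRing.scale /=; ring.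
have AX := DA _ DX; have AY := DA _ DY.
have [_ X0p] := AX0; have [_ Xp] := AX; have [_ Yp] := AY.
have z1n : `|(z1 (X, Y)).2| < 1 by apply: le_lt_trans N7; exact: norm_snd_le.
have z1v : vbox L (pt.2.1 + e.2.1 + (z1 (X, Y)).1).
  move=> i; rewrite mxE; apply: le_trans (ler_normD _ _) _.
  have := Lbox i; have := le_coord_mx_norm (z1 (X, Y)).1 i; have := norm_fst_le (z1 (X, Y)).
  lra.
have Xb0 : X.2.2 = 0 -> X0.2.2 = 0.
  move=> Xb; apply/eqP; rewrite eq_le X0p andbT leNgt; apply/negP => /N8 [].
  by rewrite Xb ltxx.
have Yb0 : Y.2.2 = 0 -> X0.2.2 = 0.
  move=> Yb; apply/eqP; rewrite eq_le X0p andbT leNgt; apply/negP => /N8 [_].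
  by rewrite Yb ltxx.
have kj0 : 0 <= k + j by rewrite addr_ge0.
have qp : X.2.2 = 0 -> q <= p by move=> Xb; rewrite /q Xb -XY0 (Xb0 Xb); exact: slope_le.
have pq : Y.2.2 = 0 -> p <= q by move=> Yb; rewrite /q Yb -XY0 (Yb0 Yb); exact: slope_ge.
have subineq : G1.1 + H X G1.2 <= 0 \/ X.2.2 = 0 /\ G1.1 + F X G1.2 <= 0.
  have [Xb|Xb] := eqVneq X.2.2 0.
    have : G1.1 + Num.min (F X G1.2) (H X G1.2) <= 0.
      by apply: ubd uG; split; [exact: DX.1|].
    by case: (leP (F X G1.2) (H X G1.2)) => _; [right|left].
  left; apply: uin uG; split; first exact: DX.1.
  by rewrite /Omega /= lt_neqAle eq_sym Xb.
have supineq : 0 <= - G2.1 + H Y (- G2.2) \/ Y.2.2 = 0 /\ 0 <= - G2.1 + F Y (- G2.2).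
  have [Yb|Yb] := eqVneq Y.2.2 0.
    have : G2.1 - Num.max (F Y (- G2.2)) (H Y (- G2.2)) <= 0.
      by apply: vbd vG; split; [exact: DY.1|].
    rewrite subr_le0 le_max ![- G2.1 + _]addrC !subr_ge0.
    by move=> /orP [h|h]; [right|left].
  left; rewrite addrC subr_ge0 -subr_le0; apply: vin vG; split; first exact: DY.1.
  by rewrite /Omega /= lt_neqAle eq_sym Yb.
have G1L : - L < G1.1 by rewrite G1t; exact: time_slope_bound Le d1 (eta2 _) N5.
have G1pd : G1.2 = (pt.2.1 + e.2.1 + (z1 (X, Y)).1, q + e.2.2 + (z1 (X, Y)).2) :> space R n.
  exact: G1x.
have P1 : `|q| <= Q -> P (pt.2.1 + e.2.1, q + e.2.2).
  by move=> qQ; split; [left|exact: in_box_shift].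
have P2 : `|q| <= Q -> P (pt.2.1, q).
  move=> qQ; split; first by right.
  by rewrite -[q]addr0; apply: in_box_shift; rewrite ?normr0.
have bdry c : c = 0 :> R -> c == 0 by move=> ->.
apply: (@slopes_absurd R (X.2.2 = 0) (Y.2.2 = 0) d L Q p q e.2.2 (z1 (X, Y)).2 G1.1 G2.1
  (H X G1.2) (F X G1.2) (H Y (- G2.2)) (F Y (- G2.2)) (h1 q) (f1 q) (h2 q) (f2 q)) => //.
- exact: ltW.
- by rewrite G1pd; exact: coH.
- by move=> Xb; rewrite G1pd; apply: coF => //; exact: DAbd.
- move=> qQ; rewrite G1t; have := N1 isT AX _ (P1 qQ).
  by rewrite -G1x => /(sum_close (pt.1 + e.1) N5) [].
- move=> Xb qQ; rewrite G1t; have := N3 (bdry _ (Xb0 Xb)) (DAbd _ DX Xb) _ (P1 qQ).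
  by rewrite -G1x => /(sum_close (pt.1 + e.1) N5) [].
- by move=> qQ; rewrite G2t; have := N2 isT AY _ (P2 qQ); rewrite -G2x => /(sum_close pt.1 N6) [].
- move=> Yb qQ; rewrite G2t; have := N4 (bdry _ (Yb0 Yb)) (DAbd _ DY Yb) _ (P2 qQ).
  by rewrite -G2x => /(sum_close pt.1 N6) [].
- by move=> Xb; apply: (pbd (Xb0 Xb)).1.
- by move=> Yb; apply: (pbd (Yb0 Yb)).2.
- exact: cmpH.
- by move=> Yb; apply: cmpF; exact: Yb0.
Qed.

(** * Bounds drawn from the structure conditions *)

Lemma coercive_pinfty (R : realType) n (A : set (spacetime R n)) H (L M : R) :
  inf_on_box A H L pd @[pd --> +oo] --> +oo%E ->
  exists Q, forall X p' pd, A X -> vbox L p' -> Q < pd -> M < H X (p', pd).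
Proof.
move=> /cvgeyPgt /(_ M) [Q [_ HQ]]; exists Q => X p' pd AX Lp /HQ.
rewrite -lte_fin => h; apply: lt_le_trans h _; apply: ereal_inf_lbound.
by exists X, p'.
Qed.

Lemma coercive_ninfty (R : realType) n (A : set (spacetime R n)) H (L M : R) :
  inf_on_box A H L pd @[pd --> -oo] --> +oo%E ->
  exists Q, forall X p' pd, A X -> vbox L p' -> pd < - Q -> M < H X (p', pd).
Proof.
move=> /cvgeyPgt /(_ M) [Q [_ HQ]]; exists (- Q) => X p' pd AX Lp.
rewrite opprK => /HQ; rewrite -lte_fin => h; apply: lt_le_trans h _.
by apply: ereal_inf_lbound; exists X, p'.
Qed.

Lemma ssq_le_sbox (R : realType) n (p : space R n) (L : R) : sbox L p ->
  ssq p <= n.+1%:R * L ^+ 2.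
Proof.
move=> [pL p2L]; have aux (b : R) : `|b| <= L -> b ^+ 2 <= L ^+ 2.
  by move=> bL; rewrite -real_normK ?num_real // lerXn2r ?nnegrE // (le_trans _ bL).
rewrite /ssq /sdot -natr1 mulrDl mul1r; apply: lerD; last by rewrite -expr2 aux.
rewrite mulr_natl -[X in _ *+ X]card_ord -sumr_const.
by apply: ler_sum => i _; rewrite -expr2 aux.
Qed.

(** The bound at zero gradient is transported by the gradient modulus of a slightly larger box,
    whose size is positive whatever the sign of [L]. *)
Lemma bounded_on_boxes (R : realType) n (A : set (spacetime R n)) wL H :
  [bounded H X 0 | X in A] -> loc_unif_continuous wL A H ->
  (forall L : R, 0 < L -> modulus (wL L)) ->
  forall L : R, exists B, forall X p, A X -> sbox L p -> `|H X p| <= B.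
Proof.
move=> [M [_ HM]] cH mw L; pose L' := `|L| + 1; have L'0 : 0 < L' by rewrite ltr_wpDl.
have L0 := normr_ge0 L; have LL := ler_norm L.
exists (M + 1 + wL L' (Num.sqrt (n.+1%:R * L ^+ 2))) => X p AX pL.
have pL' : sbox L' p.
  case: pL => p1 p2; split => [i|]; [apply: le_trans (p1 i) _|apply: le_trans p2 _];
    by rewrite /L'; lra.
have zL' : sbox L' (0 : space R n) by split => [i|]; rewrite /= ?mxE normr0 ltW.
have M1 : M < M + 1 by rewrite ltrDl.
have /= h0 := HM _ M1 _ AX; have := cH _ L'0 _ _ _ AX pL' zL'; rewrite subr0.
have [_ iw _ _] := mw _ L'0.
have : wL L' (snorm p) <= wL L' (Num.sqrt (n.+1%:R * L ^+ 2)).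
  apply: iw; rewrite ?in_itv /= ?andbT ?sqrtr_ge0 //.
  by apply: ler_wsqrtr; exact: ssq_le_sbox.
have := ler_normD (H X p - H X 0) (H X 0); rewrite subrK; lra.
Qed.

Lemma ssqBC (R : realType) n (x y : space R n) : ssq (x - y) = ssq (y - x).
Proof.
have e (z : space R n) : ssq z = sq ((0, z) : spacetime R n).
  by rewrite /sq /stdot /= mul0r add0r.
by rewrite !e -sqN; congr (sq _); congr (_, _); rewrite /= ?oppr0 // opprB.
Qed.

Lemma near_supremum (R : realType) (U : Type) (B : set U) (f : U -> R) (c a : R) z0 :
  B z0 -> (forall z, B z -> f z <= c) -> 0 < a ->
  exists z, [/\ B z, f z0 <= f z + a & forall z', B z' -> f z' <= f z + a].
Proof.
move=> Bz0 fc a0; have hs : has_sup [set f z | z in B].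
  by split; [exists (f z0), z0|exists c => _ [z Bz <-]; exact: fc].
have [_ [z Bz <-] fz] := sup_adherent a0 hs.
have h z' : B z' -> f z' <= f z + a.
  move=> Bz'; have : f z' <= sup [set f z | z in B] by apply: ub_le_sup; [exact: hs.2|exists z'].
  lra.
by exists z; split => //; exact: h.
Qed.

Lemma scale_norms_le (R : realType) n (k : R) (Z : spacetime R n) : 0 <= k ->
  vnorm (k *: Z).2.1 <= k * stnorm Z /\ snorm (k *: Z).2 <= k * stnorm Z.
Proof.
move=> k0; have e : Num.sqrt (k ^+ 2) = k by rewrite sqrtr_sqr ger0_norm.
have := sqE Z; have := sqr_ge0 Z.1; have := sqr_ge0 Z.2.2; rewrite /sq => h1 h2 h3.
rewrite /vnorm /snorm /stnorm -[in k * _]e -sqrtrM ?sqr_ge0 //; split; apply: ler_wsqrtr.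
  rewrite /= vdotZl vdotC vdotZl mulrA -expr2; apply: ler_wpM2l; first exact: sqr_ge0.
  rewrite h3; lra.
have -> : sdot (k *: Z).2 (k *: Z).2 = k ^+ 2 * sdot Z.2 Z.2.
  by rewrite /sdot /= vdotZl vdotC vdotZl /GRing.scale /=; ring.
by apply: ler_wpM2l; rewrite ?sqr_ge0 // /stdot lerDr -expr2 sqr_ge0.
Qed.

Lemma coord_le_stnorm (R : realType) n (Z : spacetime R n) :
  [/\ `|Z.1| <= stnorm Z, vbox (stnorm Z) Z.2.1 & `|Z.2.2| <= stnorm Z].
Proof.
have := sqE Z; have := sqr_ge0 Z.1; have := sqr_ge0 Z.2.2; have := vdot_ge0 Z.2.1.
move=> v0 s2 s1 e; have aux (b : R) : b ^+ 2 <= sq Z -> `|b| <= stnorm Z.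
  by move=> bZ; rewrite -sqrtr_sqr; apply: ler_wsqrtr.
split; [|move=> i|]; apply: aux; rewrite e; last by lra.
  by lra.
by have := le_coord_vdot Z.2.1 i; lra.
Qed.

Lemma exists_pos_le2 (R : realType) (x y : R) : 0 < x -> 0 < y ->
  exists z, [/\ 0 < z, z <= x & z <= y].
Proof. by move=> x0 y0; exists (Num.min x y); rewrite lt_min x0 y0 !ge_min !lexx orbT. Qed.

(** Bounds the value of [H] or [F] that enters the argument of the tangential modulus, from the
    sublevel assumption on [h1] or [f1]. *)
Lemma level_bound (R : realType) (d k rho b e c A0 A1 : R) :
  b + e + c + A1 <= d -> `|A1 - A0| <= d -> `|e| <= d -> `|b| <= k * rho -> 0 <= c -> d <= 1 ->
  A0 <= 3 + k * rho.
Proof. by rewrite !ler_norml => ? /andP [? ?] /andP [? ?] /andP [? ?] ? ?; lra. Qed.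

(** The two time gains, at least 4 d each, outweigh the four errors of size d: the level, the
    removal of [e] from the gradient, its time component and the tangential modulus. *)
Lemma level_drop (R : realType) (d b e c1 c2 A0 A1 A2 : R) :
  0 < d -> b + e + c1 + A1 <= d -> `|A1 - A0| <= d -> `|e| <= d -> 4 * d <= c1 -> 4 * d <= c2 ->
  A2 - A0 <= d -> b - c2 + A2 <= - d.
Proof. by rewrite !ler_norml => ? ? /andP [? ?] /andP [? ?] ? ? ?; lra. Qed.

(** The argument is at most 4 rho + 2 k rho^2 <= r / 2 + r / 2; this is where smallness of k rho^2,
    and not merely of rho, is needed. *)
Lemma modulus_argument_bound (R : realType) (r k rho s m : R) :
  0 <= rho -> 0 <= k -> rho <= r / 8 -> k * rho ^+ 2 <= r / 4 -> 0 <= s -> s <= k * rho ->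
  m <= 3 + k * rho -> 0 <= rho * (1 + s + Num.max 0 m) <= r.
Proof.
move=> rho0 k0 rho_r krho s0 sk mk; have kr0 : 0 <= k * rho by rewrite mulr_ge0.
have [M0 Mk] : 0 <= Num.max 0 m /\ Num.max 0 m <= 3 + k * rho.
  by rewrite le_max lexx ge_max mk addr_ge0.
apply/andP; split; first by rewrite mulr_ge0 //; lra.
have : rho * (1 + s + Num.max 0 m) <= rho * (4 + 2 * (k * rho)) by apply: ler_wpM2l => //; lra.
lra.
Qed.

Lemma penalty_gradient_small (R : realType) n (a : R) (X Xs : spacetime R n) :
  0 <= a -> sq (X - Xs) <= 1 ->
  let e := (2 * a) *: (X - Xs) in
  [/\ `|e.1| <= 2 * a, vbox (2 * a) e.2.1, `|e.2.2| <= 2 * a & snorm e.2 <= 2 * a].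
Proof.
move=> a0 XXs e; have a20 : 0 <= 2 * a by rewrite mulr_ge0.
have s1 : stnorm (X - Xs) <= 1 by rewrite -[1]sqrtr1; apply: ler_wsqrtr.
have [h1 h2 h3] := coord_le_stnorm (X - Xs); have [_ h4] := scale_norms_le (X - Xs) a20.
have aux (b : R) : `|b| <= stnorm (X - Xs) -> `|2 * a * b| <= 2 * a.
  by move=> bs; rewrite normrM ger0_norm // ler_piMr // (le_trans bs).
split; [exact: aux|move=> i|exact: aux|]; first by rewrite mxE; apply: aux; exact: h2.
by apply: le_trans h4 _; rewrite ler_piMr.
Qed.

Lemma tangential_gradient_bound (R : realType) n (k : R) (X Y : spacetime R n) : 0 <= k ->
  let pt := k *: (X - Y) in
  [/\ `|pt.1| <= k * stnorm (X - Y), vbox (k * stnorm (X - Y)) pt.2.1 &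
      vnorm pt.2.1 <= k * stnorm (X - Y)].
Proof.
move=> k0 pt; have [h1 h2 _] := coord_le_stnorm (X - Y); have [h4 _] := scale_norms_le (X - Y) k0.
split => // [|i]; first by rewrite normrM (ger0_norm k0); apply: ler_wpM2l h1.
by rewrite mxE normrM (ger0_norm k0); apply: ler_wpM2l (h2 i).
Qed.

Lemma time_penalty_bound (R : realType) (T s eta d : R) :
  0 < T -> 0 < s -> s < T -> 0 < eta -> d <= eta / (4 * T ^+ 2) -> 4 * d <= eta / (T - s) ^+ 2.
Proof.
move=> T0 s0 sT eta0 dT; have e : 4 * (eta / (4 * T ^+ 2)) = eta / T ^+ 2.
  by field; rewrite gt_eqF.
apply: (@le_trans _ _ (eta / T ^+ 2)); first by rewrite -e ler_pM2l.
have Ts : 0 < T - s by rewrite subr_gt0.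
rewrite ler_pM2l // lef_pV2 ?posrE ?exprn_gt0 // lerXn2r ?nnegrE ?ltW //; lra.
Qed.

(** * Choice of the parameters and comparison principle *)

Unset Implicit Arguments.

Theorem theorem1p1 (R : realType) (d : nat) (hd : (1 <= d)%N) (T : R) (hT : 0 < T)
    (w : R -> R) (wL : R -> R -> R)
    (hw : modulus w) (hwL : forall L : R, 0 < L -> modulus (wL L))
    (H F : spacetime R d.-1 -> space R d.-1 -> R)
    (hH : condH T w wL H) (hF : condF T w wL H F)
    (u0 : space R d.-1 -> R)
    (hu0 : unif_continuous_on (@Omegabar R d.-1) u0)
    (u v : spacetime R d.-1 -> R)
    (husc : usc_on (`[0, T[ `*` @Omegabar R d.-1) u)
    (hlsc : lsc_on (`[0, T[ `*` @Omegabar R d.-1) v)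
    (hu_int : visc_sub (`]0, T[ `*` @Omegabar R d.-1) (`]0, T[ `*` @Omega R d.-1) H u)
    (hu_bd : visc_sub (`]0, T[ `*` @Omegabar R d.-1) (`]0, T[ `*` @bdOmega R d.-1)
       (fun X p => Num.min (F X p) (H X p)) u)
    (hv_int : visc_super (`]0, T[ `*` @Omegabar R d.-1) (`]0, T[ `*` @Omega R d.-1) H v)
    (hv_bd : visc_super (`]0, T[ `*` @Omegabar R d.-1) (`]0, T[ `*` @bdOmega R d.-1)
       (fun X p => Num.max (F X p) (H X p)) v)
    (hgrowth : exists2 CT : R, 0 < CT & forall (t : R) (x : space R d.-1),
       t \in `[0, T[ -> Omegabar x -> u (t, x) <= u0 x + CT /\ u0 x - CT <= v (t, x))
    (hinit : forall x : space R d.-1, Omegabar x -> u (0, x) <= u0 x /\ u0 x <= v (0, x)) :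
  forall (t : R) (x : space R d.-1), t \in `[0, T[ -> Omegabar x -> u (t, x) <= v (t, x).
Proof.
move=> t x tT xO; rewrite leNgt; apply/negP => uv_neg.
set n := d.-1 in H F hH hF u0 hu0 u v husc hlsc hu_int hu_bd hv_int hv_bd hgrowth hinit x xO uv_neg.
pose D : set (spacetime R n) := interior_times T.
pose Din : set (spacetime R n) := `]0, T[ `*` @Omega R n.
pose Dbd : set (spacetime R n) := `]0, T[ `*` @bdOmega R n.
pose A : set (spacetime R n) := `[0, T] `*` @Omegabar R n.
pose Abd : set (spacetime R n) := `[0, T] `*` @bdOmega R n.
pose vn X := - v X.
have DinD : Din `<=` D by move=> X [Xt Xd]; split => //; exact: ltW.
have DbdD : Dbd `<=` D by move=> X [Xt Xd]; split => //; rewrite /Omegabar /= Xd.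
have DA X : D X -> A X.
  move=> [/= + XO]; rewrite in_itv /= => /andP [h0 h1].
  by split => //=; rewrite in_itv /= !ltW.
have uu : usc_in (all_times T) u := usc_on_usc husc.
have uvn : usc_in (all_times T) vn := lsc_on_usc hlsc.
have uin : psub D Din H u := visc_sub_psub DinD hu_int.
have ubd : psub D Dbd (fun X p => Num.min (F X p) (H X p)) u := visc_sub_psub DbdD hu_bd.
have vin : psub D Din (fun X p => - H X (- p)) vn := visc_super_psub DinD hv_int.
have vbd : psub D Dbd (fun X p => - Num.max (F X (- p)) (H X (- p))) vn :=
  visc_super_psub DbdD hv_bd.
have [CT CT0 growth] := hgrowth.
have gu X : all_times T X -> u X <= u0 X.2 + CT.
  by case: X => s y [/= st yO]; have [] := growth s y st yO.
have gv X : all_times T X -> vn X <= - u0 X.2 + CT.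
  by case: X => s y [/= st yO]; have [_] := growth s y st yO; rewrite /vn; lra.
have qu : quadratic_modulus u0 := unif_continuous_quadratic hu0.
have qv : quadratic_modulus (fun y => - u0 y).
  move=> k k0; have [K K0 uK] := qu k k0; exists K => // y z yO zO.
  by have := uK _ _ zO yO; rewrite ssqBC; lra.
(* Interior and boundary inequalities are merged into one over the whole domain, the form that
   [initial_estimate] takes. *)
have split_psub K1 K2 f : psub D Din K1 f -> psub D Dbd K2 f ->
    psub D D (fun X p => if X.2.2 == 0 then K2 X p else K1 X p) f.
  move=> f1 f2 X G [Xt XO] fG; case: ifPn => [/eqP Xb|Xb]; first exact: f2 fG.
  by apply: f1 fG; split => //; rewrite /Omega /= lt_neqAle eq_sym Xb.
have bdH L := bounded_on_boxes (H_bounded0 hH) (H_unif hH) hwL L.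
have bdF L := bounded_on_boxes (F_bounded0 hF) (F_unif hF) hwL L.
have box_opp L (p : space R n) : sbox L p -> sbox L (- p).
  by move=> [h1 h2]; split => [i|]; rewrite /= ?mxE normrN.
have bdK L : exists B, forall X p, D X -> sbox L p ->
    `|H X p| <= B /\ (X.2.2 = 0 -> `|F X p| <= B).
  have [B1 h1] := bdH L; have [B2 h2] := bdF L; exists (Num.max B1 B2) => X p DX pL.
  have AX := DA _ DX; split; first by rewrite le_max h1.
  by move=> Xb; rewrite le_max h2 ?orbT //; split => //; exact: AX.1.
pose s4 := (u (t, x) - v (t, x)) / 2; have s40 : 0 < s4 by rewrite /s4 divr_gt0 // subr_gt0.
have s80 : 0 < s4 / 8 by rewrite divr_gt0.
have [Lu Lu0 estu] : exists2 L, 0 <= L &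
    forall X, all_times T X -> u X <= u0 X.2 + s4 / 8 + L * X.1.
  apply: (initial_estimate CT0 uu (split_psub _ _ _ uin ubd) _ qu gu _ s80).
    move=> L; have [B hB] := bdK L; exists (- B) => X p DX pL.
    have [h1 h2] := hB _ _ DX pL; move: h1; rewrite ler_norml => /andP [h1 _].
    case: ifPn => [/eqP /h2|_ //]; rewrite ler_norml => /andP [h3 _].
    by rewrite le_min h1 h3.
  by move=> y yO; have [] := hinit y yO.
have [Lv Lv0 estv] : exists2 L, 0 <= L &
    forall X, all_times T X -> vn X <= - u0 X.2 + s4 / 8 + L * X.1.
  apply: (initial_estimate CT0 uvn (split_psub _ _ _ vin vbd) _ qv gv _ s80).
    move=> L; have [B hB] := bdK L; exists (- B) => X p DX /box_opp pL.
    have [h1 h2] := hB _ _ DX pL; move: h1; rewrite ler_norml => /andP [_ h1].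
    case: ifPn => [/eqP /h2|_]; last by rewrite lerN2.
    by rewrite ler_norml => /andP [_ h3]; rewrite lerN2 ge_max h1 h3.
  by move=> y yO; have [_] := hinit y yO; rewrite /vn; lra.
(* Two tolerances: the fine one excludes the initial time, the coarse one gives the growth bound
   [uvC]. *)
have [K1 K10 uK1] := qu _ s80.
have [K0 K00 uK0] := qu _ ltr01.
pose C := 2 * CT + 1; have C0 : 0 < C by rewrite /C; lra.
have uvC Z : same_depth T Z -> u Z.1 + vn Z.2 <= C + K0 * sq (Z.1 - Z.2).
  move=> [B1 B2 _]; have := gu _ B1; have := gv _ B2; have := uK0 _ _ B1.2 B2.2.
  have : K0 * ssq (Z.1.2 - Z.2.2) <= K0 * sq (Z.1 - Z.2).
    by apply: ler_wpM2l => //; rewrite /sq /stdot lerDr -expr2 sqr_ge0.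
  rewrite /C; lra.
have [t0 tT'] : 0 <= t /\ t < T by move: tT; rewrite in_itv /= => /andP.
(* Each time penalty equals s4 / 2 at time t, so half of the initial gap 2 s4 survives. *)
pose eta := s4 * (T - t) / 2; have eta0 : 0 < eta by rewrite divr_gt0 // mulr_gt0 // subr_gt0.
have BP : same_depth T ((t, x), (t, x)) by split.
have DP k : doubled T eta k u vn ((t, x), (t, x)) = s4.
  rewrite /doubled /= subrr /sq stdot0 mulr0 subr0 /eta /vn /s4.
  by field; rewrite subr_eq0 gt_eqF.
have [dl [dl0 dl1 dle]] : exists z, [/\ 0 < z, z <= 1 & z <= eta / (4 * T ^+ 2)].
  by apply: exists_pos_le2; rewrite // divr_gt0 // mulr_gt0 // exprn_gt0.
have [rw rw0 wsmall] := modulus_small hw dl0.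
(* Gives k rho^2 <= 8 th <= rw / 4, as [modulus_argument_bound] requires. *)
have [th [th0 th1 thr]] : exists z, [/\ 0 < z, z <= 1 & z <= rw / 32].
  by apply: exists_pos_le2; rewrite // divr_gt0.
(* Points closer than [r0] are too close for either of them to be at time 0. *)
pose r0 := s4 / (4 * (K1 + Lu + Lv + 1)).
have r00 : 0 < r0 by rewrite divr_gt0 // mulr_gt0 //; lra.
have [rr [rr0 rr1 rr']] : exists z, [/\ 0 < z, z <= 1 & z <= Num.min (rw / 8) r0].
  by apply: exists_pos_le2; rewrite // lt_min r00 divr_gt0.
have [rrw rr2] : rr <= rw / 8 /\ rr <= r0 by move: rr'; rewrite le_min => /andP.
pose g (Z : spacetime R n * spacetime R n) := sq (Z.1 - Z.2) / 2.
pose f (Z : spacetime R n * spacetime R n) :=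
  u Z.1 + vn Z.2 - eta / (T - Z.1.1) - eta / (T - Z.2.1).
have dblE k Z : doubled T eta k u vn Z = f Z - k * g Z by rewrite /doubled /f /g; lra.
have fC k Z : 2 * (K0 + 1) <= k -> same_depth T Z -> f Z - k * g Z <= C.
  move=> kK BZ; have := uvC _ BZ; have [[/= + _] [/= + _] _] := BZ.
  rewrite !in_itv /= => /andP [_ h1] /andP [_ h2].
  have : 0 < eta / (T - Z.1.1) by rewrite divr_gt0 // subr_gt0.
  have : 0 < eta / (T - Z.2.1) by rewrite divr_gt0 // subr_gt0.
  have : 0 <= (k / 2 - K0) * sq (Z.1 - Z.2) by rewrite mulr_ge0 ?sq_ge0 //; lra.
  rewrite /f /g; lra.
have k00 : 0 < 2 * (K0 + 1) by rewrite mulr_gt0 //; lra.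
have gP0 : g ((t, x), (t, x)) = 0 by rewrite /g /= subrr /sq stdot0 mul0r.
have gP Z : same_depth T Z -> 0 <= g Z by rewrite /g divr_ge0 ?sq_ge0.
have [k1 kk1 pen] := penalization k00 BP gP0 gP fC th0.
(* The second bound turns k rho^2 <= 8 into rho <= rr. *)
pose k := Num.max k1 (8 / rr ^+ 2).
have [k1k k8] : k1 <= k /\ 8 / rr ^+ 2 <= k by rewrite /k !le_max !lexx orbT.
have rr20 : 0 < rr ^+ 2 by rewrite exprn_gt0.
have kpos : 0 < k by apply: lt_le_trans k8; rewrite divr_gt0.
have krr : 8 <= k * rr ^+ 2 by rewrite -ler_pdivrMr.
(* Time and tangential slopes are at most k rho <= k; one unit is for [e], the other for the
   deviation of the doubled points. *)
pose L := k + 2; have L0 : 0 < L by rewrite /L addr_gt0.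
have [Q1 HQ1] := coercive_pinfty (L := L) L (H_coercive hH L0).1.
have [Q2 HQ2] := coercive_ninfty (L := L) L (H_coercive hH L0).2.
have [Q3 HQ3] := coercive_ninfty (L := L) L (F_semicoercive hF L0).
pose Q := `|Q1| + `|Q2| + `|Q3| + 3.
have [q1 q2 q3] : [/\ 0 <= `|Q1|, 0 <= `|Q2| & 0 <= `|Q3|] by [].
have [q1' q2' q3'] : [/\ Q1 <= `|Q1|, Q2 <= `|Q2| & Q3 <= `|Q3|] by rewrite !ler_norm.
pose L2 := L + Q + 2; have L20 : 0 < L2 by rewrite /L2 /Q; move: q1 q2 q3 L0; clear; lra.
have [ra ra0 wLsmall] := modulus_small (hwL _ L20) dl0.
(* [a] is chosen after [k], [L] and [Q], because [ra] depends on the box [L2]. It must keep the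
   maximizer within reach of [pen], preserve the positive gap, and make [e] and the cost of removing
   it at most [dl]. *)
have [a1 [a10 a1th a1s4]] : exists z, [/\ 0 < z, z <= th & z <= s4 / 4].
  by apply: exists_pos_le2; rewrite // divr_gt0.
have [a2 [a20 a2dl a2ra]] : exists z, [/\ 0 < z, z <= dl / 2 & z <= ra / 2].
  by apply: exists_pos_le2; rewrite divr_gt0.
have [a [a0 aa1 aa2]] := exists_pos_le2 a10 a20.
have [ath as4] : a <= th /\ a <= s4 / 4 by split; exact: le_trans aa1 _.
have [adl ara] : 2 * a <= dl /\ 2 * a <= ra.
  by rewrite -!ler_pdivlMl // ![2^-1 * _]mulrC; split; exact: le_trans aa2 _.
have kK2 : 2 * (K0 + 1) <= k by exact: le_trans k1k.
have dC Z : same_depth T Z -> doubled T eta k u vn Z <= C by rewrite dblE; exact: fC.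
have [Zs [BZs PZs Zsmax]] := near_supremum BP dC a0.
rewrite DP in PZs.
have Zs0 : 0 <= doubled T eta k u vn Zs by move: PZs as4 s40; clear; lra.
have kK3 : K0 + 1 <= k / 2 by move: kK2; clear; lra.
have [[X0 Y0] [BZ0 Z0s Zs_le Z0max]] :=
  same_depth_maximum C0 eta0 a0 kK3 uu uvn uvC BZs Zs0 Zsmax.
have [AX0 AY0 /= XY0] := BZ0; rewrite /= in AX0 AY0 Z0s Z0max.
(* [Z0] does at least as well as [Zs], hence is itself maximal up to a <= th. *)
have kg : k * g (X0, Y0) <= 4 * th.
  apply: pen k1k _ BZ0 _ => Z BZ; rewrite -!dblE.
  by move: (Zsmax _ BZ) Zs_le ath; clear; lra.
pose rho := stnorm (X0 - Y0); have rho0 : 0 <= rho by exact: sqrtr_ge0.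
have rho2 : rho ^+ 2 = sq (X0 - Y0) by rewrite sqr_sqrtr // sq_ge0.
have krho : k * rho ^+ 2 <= 8 * th by move: kg; rewrite /g /= -rho2; clear; lra.
have rho_rr : rho <= rr.
  rewrite -(ler_pXn2r (n := 2)) ?nnegrE //; last exact: ltW.
  by rewrite -(ler_pM2l kpos); move: krho krr th1; clear; lra.
have rho1 : rho <= 1 by exact: le_trans rr1.
have krho1 : k * rho <= k by rewrite ler_piMr // ltW.
have [X0O Y0O] : Omegabar X0.2 /\ Omegabar Y0.2 by case: AX0; case: AY0.
have [X0t X0T] : 0 <= X0.1 /\ X0.1 < T by case: AX0 => /=; rewrite in_itv /= => /andP.
have [Y0t Y0T] : 0 <= Y0.1 /\ Y0.1 < T by case: AY0 => /=; rewrite in_itv /= => /andP.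
have [tt tx td] := coord_le_stnorm (X0 - Y0).
have gapXY : s4 / 2 < u X0 + vn Y0.
  have := Zs_le; rewrite {2}/doubled /=.
  have : 0 < eta / (T - X0.1) by rewrite divr_gt0 // subr_gt0.
  have : 0 < eta / (T - Y0.1) by rewrite divr_gt0 // subr_gt0.
  have : 0 <= k / 2 * sq (X0 - Y0) by rewrite mulr_ge0 ?sq_ge0 ?divr_ge0 ?ltW.
  move: PZs as4 s40; clear; lra.
have u0XY : u0 X0.2 - u0 Y0.2 <= s4 / 8 + K1 * rho.
  apply: le_trans (uK1 _ _ X0O Y0O) _; rewrite lerD2l ler_wpM2l //.
  apply: (@le_trans _ _ (rho ^+ 2)); last by rewrite expr2 ler_piMr.
  by rewrite rho2 /sq /stdot lerDr -expr2 sqr_ge0.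
have rho_r0 : (K1 + Lu + Lv + 1) * rho <= s4 / 4.
  have h : 0 < K1 + Lu + Lv + 1 by move: K10 Lu0 Lv0; clear; lra.
  have : rho <= r0 by exact: le_trans rr2.
  by rewrite /r0 ler_pdivlMr ?mulr_gt0 //; clear; lra.
have [p1 p2] : 0 <= Lu * rho /\ 0 <= Lv * rho by rewrite !mulr_ge0.
have p3 : 0 <= K1 * rho by rewrite mulr_ge0.
(* At X0.1 = 0 the other time is at most rho, so [estv] and [u0XY] bound the gap by s4 / 4 + (K1 +
   Lv) rho <= s4 / 2, against [gapXY]. *)
have X0pos : 0 < X0.1.
  rewrite lt_neqAle X0t andbT; apply/eqP => X00.
  have := (hinit _ X0O).1; have -> : (0, X0.2) = X0 by rewrite X00; case: (X0).
  have := estv _ AY0; have : Lv * Y0.1 <= Lv * rho.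
    apply: ler_wpM2l => //; move: tt; rewrite /= -X00 sub0r normrN.
    by apply: le_trans; exact: ler_norm.
  move: gapXY u0XY rho_r0 p1 p2 p3 rho0 s40; clear; lra.
have Y0pos : 0 < Y0.1.
  rewrite lt_neqAle Y0t andbT; apply/eqP => Y00.
  have := (hinit _ Y0O).2; have -> : (0, Y0.2) = Y0 by rewrite Y00; case: (Y0).
  have := estu _ AX0; have : Lu * X0.1 <= Lu * rho.
    apply: ler_wpM2l => //; move: tt; rewrite /= -Y00 subr0.
    by apply: le_trans; exact: ler_norm.
  rewrite /vn in gapXY; move: gapXY u0XY rho_r0 p1 p2 p3 rho0 s40; clear; lra.
have DX0 : D X0 by split => //=; rewrite in_itv /= X0pos X0T.
have DY0 : D Y0 by split => //=; rewrite in_itv /= Y0pos Y0T.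
have [e1 ex ed en] := penalty_gradient_small (ltW a0) Z0s.
have [pt1 ptx ptn] := tangential_gradient_bound X0 Y0 (ltW kpos).
rewrite -/rho in pt1 ptx ptn.
set e := (2 * a) *: (X0 - Zs.1) in e1 ex ed en; set pt := k *: (X0 - Y0) in pt1 ptx ptn.
have c1 : 4 * dl <= eta / (T - X0.1) ^+ 2 by exact: time_penalty_bound dle.
have c2 : 4 * dl <= eta / (T - Y0.1) ^+ 2 by exact: time_penalty_bound dle.
have c10 : 0 <= eta / (T - X0.1) ^+ 2 by apply: le_trans c1; rewrite mulr_ge0 // ltW.
have [a_1 e_dl] : 2 * a <= 1 /\ `|e.1| <= dl.
  by split; [exact: (le_trans adl dl1)|exact: (le_trans e1 adl)].
have Q0 : 3 <= Q by rewrite /Q; move: q1 q2 q3; clear; lra.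
have k2 : k + 1 <= L2 by rewrite /L2 /L; move: Q0; clear; lra.
have box1 q : `|q| <= Q -> sbox L2 (pt.2.1, q).
  move=> qQ; split => [i|] /=.
    by apply: le_trans (ptx i) _; move: krho1 k2; clear; lra.
  by rewrite /L2; move: qQ L0; clear; lra.
have box2 q : `|q| <= Q -> sbox L2 (pt.2.1 + e.2.1, q + e.2.2).
  move=> qQ; split => [i|] /=.
    rewrite mxE; apply: le_trans (ler_normD _ _) _.
    by move: (ptx i) (ex i) krho1 k2 a_1; clear; lra.
  apply: le_trans (ler_normD _ _) _.
  by rewrite /L2; move: qQ L0 ed a_1; clear; lra.
have en0 : 0 <= snorm e.2 by exact: sqrtr_ge0.
(* Removing [e] from the gradient costs at most [dl], for [H] and [F] alike. *)
have closeK B K q : B X0 -> loc_unif_continuous wL B K -> `|q| <= Q ->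
    `|K X0 (pt.2.1 + e.2.1, q + e.2.2) - K X0 (pt.2.1, q)| <= dl.
  move=> BX0 cK qQ; apply: le_trans (cK _ L20 _ _ _ BX0 (box2 _ qQ) (box1 _ qQ)) _.
  have -> : (pt.2.1 + e.2.1, q + e.2.2) - (pt.2.1, q) = e.2 :> space R n.
    by case: (e.2) => e21 e22; congr (_, _); rewrite /= addrC addKr.
  by apply: wLsmall; [exact: en0|exact: (le_trans en ara)].
have wdrop (m : R) : m <= 3 + k * rho ->
    w (stnorm (Y0 - X0) * (1 + vnorm pt.2.1 + Num.max 0 m)) <= dl.
  move=> mk; have -> : stnorm (Y0 - X0) = rho.
    by rewrite /rho /stnorm; congr Num.sqrt; exact: sqBC.
  have krho' : k * rho ^+ 2 <= rw / 4 by move: krho thr; clear; lra.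
  have /andP [h1 h2] := modulus_argument_bound rho0 (ltW kpos) (le_trans rho_rr rrw) krho'
    (sqrtr_ge0 _ : 0 <= vnorm pt.2.1) ptn mk.
  exact: wsmall.
have X0E : X0 = (X0.1, (X0.2.1, X0.2.2)) by case: (X0) => ? [].
have Y0E : Y0 = (Y0.1, (Y0.2.1, X0.2.2)) by rewrite XY0; case: (Y0) => ? [].
have AX0' := DA _ DX0; have AY0' := DA _ DY0.
apply: (@doubled_maximum_absurd R n T k a eta dl L Q H F u vn X0 Y0 Zs.1); rewrite -?/e -?/pt.
- exact: ltW.
- exact: ltW.
- exact: ltW.
- exact: dl0.
- exact: dl1.
- by move: Q0; clear; lra.
- exact: uu.
- exact: uvn.
- exact: uin.
- exact: ubd.
- exact: vin.
- exact: vbd.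
- exact: H_continuous hH.
- exact: F_continuous hF.
- exact: F_nonincreasing hF.
- exact: DX0.
- exact: DY0.
- exact: XY0.
- by case: BZs => -[].
- exact: Z0max.
- exact: (le_trans ed a_1).
- rewrite /L; move: pt1 e1 krho1 a_1; rewrite !ler_norml.
  by move=> /andP [b1 _] /andP [b2 _]; move: b1 b2; clear; lra.
- move=> i; rewrite mxE; apply: le_trans (ler_normD _ _) _.
  by rewrite /L; move: (ptx i) (ex i) krho1 a_1; clear; lra.
- move=> X p' pd AX pL; rewrite ler_normr => /orP [h|h].
    by apply: HQ1 => //; apply: le_lt_trans q1' _; move: h q2 q3; rewrite /Q; clear; lra.
  apply: HQ2 => //; rewrite ltrNr; apply: le_lt_trans q2' _.
  by move: h q1 q3; rewrite /Q; clear; lra.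
- move=> X p' pd AX pL h; apply: HQ3 => //; rewrite ltrNr; apply: le_lt_trans q3' _.
  by move: h q1 q2; rewrite /Q; clear; lra.
- move=> q qQ h1; have cl := closeK _ _ _ AX0' (H_unif hH) qQ.
  have hb := level_bound h1 cl e_dl pt1 c10 dl1.
  apply: (level_drop dl0 h1 cl e_dl c1 c2).
  apply: (le_trans _ (wdrop _ hb)).
  have := H_tangential hH X0.2.1 Y0.2.1 (pt.2.1, q) AX0'.1 AY0'.1 X0O.
  by rewrite /= -X0E -Y0E.
- move=> Xb q qQ h1 f1; have clH := closeK _ _ _ AX0' (H_unif hH) qQ.
  have bX0 : Abd X0 by split; [exact: AX0'.1|].
  have bY0 : Abd Y0 by split; [exact: AY0'.1|rewrite /bdOmega /= -XY0].
  have clF := closeK _ _ _ bX0 (F_unif hF) qQ.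
  have hb := level_bound h1 clH e_dl pt1 c10 dl1.
  have fb := level_bound f1 clF e_dl pt1 c10 dl1.
  apply: (level_drop dl0 f1 clF e_dl c1 c2).
  (* The modulus for [F] involves max(F, H), so both sublevel bounds are needed. *)
  have mb : Num.max (F X0 (pt.2.1, q)) (H X0 (pt.2.1, q)) <= 3 + k * rho by rewrite ge_max fb.
  by apply: (le_trans _ (wdrop _ mb)); exact: (F_tangential hF).
Qed.
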